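(* Let $R=N\oplus Q$ be a finite-dimensional complex solvable Leibniz algebra with nilradical $N$, where $Q$ is a vector subspace complementary to $N$. Suppose $\dim Q=\dim(N/N^2)=k$ and that $N$ is non-split. Then $R$ is isomorphic to a unique algebra with the following table of multiplications in a basis $\{e_1,\dots,e_n,x_1,\dots,x_k\}$ adapted to $N$ in the sense of the context (all products of basis elements not listed being zero): $$\begin{array}{ll} [e_i,e_j]=\sum\limits_{t=k+1}^{n}\gamma_{i,j}^te_t, & 1\le i,j\le n,\\ {[e_i,x_i]}=e_i, & 1\le i\le k,\\ {[x_i,e_i]}=-e_i, & 1\le i\le k_1,\\ {[e_i,x_j]}=\alpha_{i,j}e_i, & k+1\le i\le n,\ 1\le j\le k,\\ {[x_j,e_i]}=\sum\limits_{t=1}^{q}\beta_{j,i}^{i_t}e_{i_t}, & k+1\le i\le n,\ 1\le j\le k, \end{array}$$ where $\gamma_{i,j}^t\in\mathbb{C}$ are the structure constants of $N$, $\beta_{j,i}^{i_t}\in\mathbb{C}$, $\alpha_{i,j}$ is the number of occurrences of the generator basis element $e_j$ in the expression of the non-generator basis element $e_i$, and, for each $i$, $\{e_{i_1},\dots,e_{i_q}\}$ is the set of all non-generator basis elements having the same structure as $e_i$.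
   Context: All algebras and vector spaces are finite-dimensional over $\mathbb{C}$. A (right) Leibniz algebra is a vector space $L$ with a bilinear bracket satisfying $[[x,y],z]=[[x,z],y]+[x,[y,z]]$ for all $x,y,z\in L$. Put $L^1=L$, $L^{m+1}=[L^m,L]$ and $L^{[1]}=L$, $L^{[m+1]}=[L^{[m]},L^{[m]}]$; $L$ is nilpotent (resp. solvable) if $L^m=0$ (resp. $L^{[m]}=0$) for some $m$. The nilradical is the maximal nilpotent ideal. The right annihilator is $Ann_r(L)=\{x\in L : [y,x]=0\ \text{for all } y\in L\}$. An algebra is non-split if it is not a direct sum of two nonzero ideals. Adapted basis: $\{e_1,\dots,e_n\}$ is a basis of $N$; $e_1,\dots,e_k$ are generators of $N$ (their classes form a basis of $N/N^2$), ordered so that $\{e_1,\dots,e_{k_1}\}\cap Ann_r(N)=\emptyset$ and $\{e_{k_1+1},\dots,e_k\}\subset Ann_r(N)$; each non-generator basis element $e_i$, $k+1\le i\le n$, lies in $N^2$ and is an iterated bracket $e_i=[[\cdots[[e_{p_1},e_{p_2}],e_{p_3}],\cdots],e_{p_m}]$, $m\ge2$, of generators from $\{e_1,\dots,e_k\}$; and $x_1,\dots,x_k$ span a complement of $N$ in $R$. The number $\alpha_{i,j}$ is the number of indices $l$ with $p_l=j$ in the word expressing $e_i$. Two non-generator basis elements $e_i,e_r$ have the same structure if each generator occurs the same number of times in both, i.e. $\alpha_{i,p}=\alpha_{r,p}$ for all $1\le p\le k$ (so $q$ depends on $i$).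
   Formalization: The case dim N = 1 is excluded, since the statement fails there: for the Lie algebra [e,x] = e = -[x,e], N = <e> lies in Ann_r(N), so k_1 = 0 and the table would force [x_1,e_1] = 0. *)

(* Defs.v *)
From mathcomp Require Import all_boot all_order all_algebra.
From mathcomp Require Import sesquilinear.
From mathcomp Require Import reals.
From mathcomp.real_closed Require Export complex.

Set Implicit Arguments.
Unset Strict Implicit.
Unset Printing Implicit Defensive.

Import GRing.Theory.
Local Open Scope ring_scope.

(* An algebra is a finite-dimensional vector space L with a bilinear bracket
   br; subalgebras and ideals are subspaces of L. *)

Section Leibniz.

Variables (F : fieldType) (L : vectType F) (br : {bilinear L -> L -> L}).

Implicit Types (U V I J N : {vspace L}).

(* Right Leibniz identity. *)
Definition leibniz_identity :=
  forall x y z, br (br x y) z = br (br x z) y + br x (br y z).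

(* [U, V]: by bilinearity, the brackets of basis vectors span it. *)
Definition brv U V : {vspace L} :=
  <<[seq br u v | u <- vbasis U, v <- vbasis V]>>%VS.

(* Both series are indexed from 0: lower_central U m is U^(m+1). *)
Fixpoint lower_central U (m : nat) : {vspace L} :=
  if m is m'.+1 then brv (lower_central U m') U else U.

Fixpoint derived_series U (m : nat) : {vspace L} :=
  if m is m'.+1 then brv (derived_series U m') (derived_series U m') else U.

Definition nilpotent U := exists m, lower_central U m = 0%VS.

Definition solvable U := exists m, derived_series U m = 0%VS.

(* I is a two-sided ideal of the subalgebra U. *)
Definition ideal U I := [/\ (I <= U)%VS, (brv I U <= I)%VS & (brv U I <= I)%VS].

Definition nilradical N :=
  [/\ ideal fullv N, nilpotent N &
      forall I, ideal fullv I -> nilpotent I -> (I <= N)%VS].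

Definition right_annihilator U x := x \in U /\ forall y, y \in U -> br y x = 0.

Definition non_split U :=
  forall I J, ideal U I -> ideal U J ->
  (I + J)%VS = U -> (I :&: J)%VS = 0%VS -> I = 0%VS \/ J = 0%VS.

(* [[...[[g p1, g p2], g p3], ...], g pm] for the word p1 p2 ... pm. *)
Definition iter_bracket k (g : 'I_k -> L) (p : seq 'I_k) : L :=
  if p is p1 :: p' then foldl (fun u l => br u (g l)) (g p1) p' else 0.

Section Basis.

(* n = k + m.  The generators e_1, ..., e_k are the e (lshift m i), i : 'I_k;
   the non-generators e_(k+1), ..., e_n are the e (rshift k i), i : 'I_m, and
   w i is the word in the generators that expresses e (rshift k i). *)
Variables (k m : nat) (e : 'I_(k + m) -> L) (x : 'I_k -> L).
Variables (k1 : nat) (w : 'I_m -> seq 'I_k).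

Definition alpha (i : 'I_m) (j : 'I_k) : nat := count_mem j (w i).

Definition same_structure (i r : 'I_m) : bool :=
  [forall p, alpha i p == alpha r p].

Definition generators : {vspace L} := <<[seq e (lshift m i) | i : 'I_k]>>%VS.

Record adapted_basis N : Prop := AdaptedBasis {
  adapted_N : basis_of N [seq e i | i : 'I_(k + m)];
  (* The e_i being free, the next two fields say that the classes of the
     generators form a basis of N / N^2. *)
  adapted_gen_sum : (generators + brv N N)%VS = N;
  adapted_gen_cap : (generators :&: brv N N)%VS = 0%VS;
  adapted_k1 : (k1 <= k)%N;
  adapted_annr : forall i : 'I_k,
    (i < k1)%N <-> ~ right_annihilator N (e (lshift m i));
  adapted_nongen : forall i : 'I_m, e (rshift k i) \in brv N N;
  adapted_size_word : forall i : 'I_m, (2 <= size (w i))%N;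
  adapted_word : forall i : 'I_m,
    e (rshift k i) = iter_bracket (fun j => e (lshift m j)) (w i);
  adapted_x_free : free [seq x j | j : 'I_k];
  adapted_x_sum : (N + <<[seq x j | j : 'I_k]>>)%VS = fullv;
  adapted_x_cap : (N :&: <<[seq x j | j : 'I_k]>>)%VS = 0%VS
}.

Variables (gamma : 'I_(k + m) -> 'I_(k + m) -> 'I_m -> F).
Variables (beta : 'I_k -> 'I_m -> 'I_m -> F).

Record multiplication_table : Prop := MultiplicationTable {
  table_ee : forall i j,
    br (e i) (e j) = \sum_t gamma i j t *: e (rshift k t);
  table_gen_x : forall i j : 'I_k,
    br (e (lshift m i)) (x j) = if i == j then e (lshift m i) else 0;
  table_x_gen : forall j i : 'I_k,
    br (x j) (e (lshift m i)) =
      if (i == j) && (i < k1)%N then - e (lshift m i) else 0;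
  table_nongen_x : forall (i : 'I_m) (j : 'I_k),
    br (e (rshift k i)) (x j) = (alpha i j)%:R *: e (rshift k i);
  table_x_nongen : forall (j : 'I_k) (i : 'I_m),
    br (x j) (e (rshift k i)) =
      \sum_(t | same_structure i t) beta j i t *: e (rshift k t);
  table_xx : forall i j, br (x i) (x j) = 0
}.

End Basis.

Definition has_table k N : Prop :=
  exists (m : nat) (e : 'I_(k + m) -> L) (x : 'I_k -> L) (k1 : nat)
         (w : 'I_m -> seq 'I_k)
         (gamma : 'I_(k + m) -> 'I_(k + m) -> 'I_m -> F)
         (beta : 'I_k -> 'I_m -> 'I_m -> F),
    adapted_basis e x k1 w N /\ multiplication_table e x k1 w gamma beta.

End Leibniz.

(* The subalgebras U of L and V of A are isomorphic; every linear map U -> A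
   is the restriction of some f : 'Hom(L, A). *)
Definition isomorphic (F : fieldType) (L A : vectType F)
    (brL : {bilinear L -> L -> L}) (U : {vspace L})
    (brA : {bilinear A -> A -> A}) (V : {vspace A}) : Prop :=
  exists f : 'Hom(L, A),
    [/\ (f @: U)%VS = V, {in U &, injective f} &
        {in U &, forall x y, f (brL x y) = brA (f x) (f y)}].

(* Main.v *)
Require Import Defs.
From HB Require Import structures.
From mathcomp Require Import all_boot all_order all_algebra.
From mathcomp Require Import sesquilinear spectral ring.
From mathcomp Require Import reals.
From mathcomp.real_closed Require Import complex.

(** Existence. Right multiplications of R form a solvable Lie algebra of operators, so by Lie's
    theorem ([lie_trigonalization]) they are simultaneously triangular. The elements whose
    triangular matrices have zero diagonal form an ideal; it is nilpotent because its lower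
    central series descends the flag. Hence the nilradical N contains [R, R] and every x whose
    right multiplication is nilpotent ([nilradical_criterion]).

    It follows that R / N acts on N / N^2 by commuting operators, and that only 0 acts
    nilpotently: an operator nilpotent on N / N^2 is nilpotent on N, because N / N^2 generates N.
    As dim R / N = dim N / N^2 = k, the k diagonal characters are coordinates on R / N. An element
    with distinct weights diagonalises the whole action ([weights_on_generators]), and an element z
    with all weights 1 acts on N^m / N^(m+1) with the single eigenvalue m. So right multiplication
    by z is invertible on N, and its kernel is an abelian complement of N; the basis x_j of this
    kernel dual to the weights and the corresponding eigenvectors e_i satisfy
    [e_i, x_j] = delta_ij e_i exactly ([diagonal_frame_exists]). The right multiplications by the
    x_j are derivations, so every word in the e_i is a common eigenvector whose weights count the
    letters; a basis of N made of words gives the table. Left multiplication by x_j commutes with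
    these derivations, so it preserves the weight spaces. That leaves [x_j, e_i] = c_ji e_i, and
    since [a, b] + [b, a] is annihilated from the left, c_ii is 0 or -1 and the other c_ji vanish.
    The value -1 at a generator e_i in Ann_r(N) would make e_i span a direct summand of N
    ([not_central_summand]), contrary to the hypotheses on N.

    Uniqueness. Two tables over isomorphic nilradicals give two generating systems of N, each
    diagonal for k commuting derivations. These two tori of derivations are conjugate under Aut(N).
    The only source of automorphisms is [leading_part_automorphism]: if D and D' are diagonal
    derivations and each generator e_i, of D-weight w_i, is f_i plus D'-eigenvectors of weights
    smaller than w_i, with D' f_i = w_i f_i, and the f_i generate N, then e_i |-> f_i extends to an
    automorphism. With the opposites of the total degrees as D and D' this reduces the second system
    to linear combinations of the first ([torus_linear_part]). Then the lines spanned by generators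
    are exchanged one at a time, as in the Steinitz lemma ([torus_exchange], [torus_conjugate]). The
    resulting isomorphism of nilradicals matches the e_i up to scalars and order. Sending the x_i
    accordingly extends it to R ([torus_extension_isomorphic]): the left and right multiplications by x_i are determined
    by their values on generators, and [x_i, e_i] by whether e_i lies in Ann_r(N). *)

Set Implicit Arguments.
Unset Strict Implicit.
Unset Printing Implicit Defensive.

Import Order.TTheory GRing.Theory Num.Theory passmx.
Local Open Scope ring_scope.

(** * Brackets of subspaces *)

Section Basics.
Variables (F : fieldType) (L : vectType F) (br : {bilinear L -> L -> L}).
Implicit Types (U V : {vspace L}).

Lemma brDl u v w : br (u + v) w = br u w + br v w. Proof. exact: linearDl. Qed.
Lemma brBl u v w : br (u - v) w = br u w - br v w. Proof. exact: linearBl. Qed.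
Lemma brZl a u v : br (a *: u) v = a *: br u v. Proof. exact: linearZl_LR. Qed.
Lemma brDr u v w : br w (u + v) = br w u + br w v. Proof. exact: linearDr. Qed.
Lemma brBr u v w : br w (u - v) = br w u - br w v. Proof. exact: linearBr. Qed.
Lemma brZr a u v : br v (a *: u) = a *: br v u. Proof. exact: linearZr_LR. Qed.
Lemma br0r u : br u 0 = 0. Proof. exact: linear0r. Qed.
Lemma br0l u : br 0 u = 0. Proof. exact: linear0l. Qed.
Lemma br_suml I (r : seq I) (P : pred I) (E : I -> L) v :
  br (\sum_(i <- r | P i) E i) v = \sum_(i <- r | P i) br (E i) v.
Proof. exact: linear_sumlz. Qed.

Definition radm (x : L) : 'End(L) := linfun (applyr br x).
Definition ladm (x : L) : 'End(L) := linfun (br x).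

Lemma radmE x v : radm x v = br v x. Proof. by rewrite lfunE. Qed.
Lemma ladmE x v : ladm x v = br x v. Proof. by rewrite lfunE. Qed.

Lemma mem_brv U V u v : u \in U -> v \in V -> br u v \in brv br U V.
Proof.
move=> uU vV; rewrite (coord_vbasis uU) (coord_vbasis vV) br_suml.
apply: memv_suml => i _; rewrite linear_sumr; apply: memv_suml => j _.
rewrite brZl linearZ /=; do 2! apply: memvZ; apply: memv_span.
by apply: allpairs_f; rewrite mem_nth ?size_tuple.
Qed.

Lemma brv_subP U V (W : {vspace L}) :
  (forall u v, u \in U -> v \in V -> br u v \in W) -> (brv br U V <= W)%VS.
Proof.
move=> h; apply/span_subvP => w /allpairsP[[u v] [/= uU vV ->]].
by apply: h; apply: vbasis_mem.
Qed.

Lemma brvS U U' V V' : (U <= U')%VS -> (V <= V')%VS -> (brv br U V <= brv br U' V')%VS.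
Proof.
move=> /subvP sU /subvP sV; apply: brv_subP => u v uU vV.
by apply: mem_brv; auto.
Qed.

Lemma derived_seriesS U m :
  derived_series br U m.+1 = derived_series br (brv br U U) m.
Proof. by elim: m => //= m ->. Qed.

End Basics.

Section HomOfLinear.
Variables (F : fieldType) (U V : vectType F) (f : U -> V) (H : linear f).
Definition hom_of_linear : 'Hom(U, V) :=
  linfun (HB.pack f (GRing.isLinear.Build _ _ _ _ _ H) : {linear U -> V}).
Lemma hom_of_linearE x : hom_of_linear x = f x.
Proof. by rewrite lfunE. Qed.
End HomOfLinear.

(** * Lie's theorem for right multiplications *)

Section Lie.
Variable C : numClosedFieldType.

(** The step of Lie's theorem that needs characteristic 0. On the cyclic space spanned by the
    [v *m X ^ j], every [S t] is triangular with the constant diagonal [lam t]. At the first linear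
    dependence, of [v *m X ^ r] on the earlier vectors, the entry just below the diagonal is
    [r * lam (d t)]; comparing it with the dependence gives [r * lam (d t) = 0]. *)
Lemma weight_bracket_eq0 n (T : Type) (P : T -> Prop) (d : T -> T) (S : T -> 'M[C]_n)
    (lam : T -> C) (X : 'M[C]_n) (v : 'rV[C]_n) :
  v != 0 -> (forall t, P t -> P (d t)) ->
  (forall t, P t -> v *m S t = lam t *: v) ->
  (forall t, P t -> X *m S t - S t *m X = S (d t)) ->
  forall t, P t -> lam (d t) = 0.
Proof.
move=> v0 Pd vS XS.
pose w j := iter j (fun u => u *m X) v.
have wS j : w j.+1 = w j *m X by [].
pose V := fix V j : {vspace 'rV[C]_n} := if j is j'.+1 then (V j' + <[w j']>)%VS else 0%VS.
have VS j : V j.+1 = (V j + <[w j]>)%VS by [].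
have VX j u : u \in V j -> u *m X \in V j.+1.
  elim: j u => [|j IH] u; first by rewrite memv0 => /eqP ->; rewrite mul0mx mem0v.
  rewrite VS => /memv_addP[a aV [b /vlineP[c ->] ->]].
  by rewrite mulmxDl -scalemxAl -wS VS memv_add ?IH ?memvZ ?memv_line.
have sub j u : u \in V j -> u \in V j.+1.
  by apply/subvP; rewrite VS addvSl.
have wV j : w j \in V j.+1 by apply: (subvP (addvSr _ _)); apply: memv_line.
(* Modulo V j, the vector w j is an eigenvector of every S t. *)
have key j t : P t -> w j *m S t - lam t *: w j \in V j.
  elim: j t => [|j IH] t Pt; first by rewrite /= vS // subrr mem0v.
  have -> : w j.+1 *m S t - lam t *: w j.+1 =
     (w j *m S t - lam t *: w j) *m X + (w j *m S (d t) - lam (d t) *: w j)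
       + lam (d t) *: w j.
    rewrite -XS // mulmxBr mulmxBl -scalemxAl !mulmxA -wS.
    move: (w j *m S t *m X) (w j.+1 *m S t) (w j.+1) (w j) => p q r u.
    by apply/rowP => i; rewrite !mxE; ring.
  apply: rpredD; last exact: memvZ.
  apply: rpredD; first exact/VX/IH.
  exact/sub/IH/Pd.
(* The next coefficient, modulo V j: this is where the factor j + 1 appears. *)
have key2 j t : P t ->
    w j.+1 *m S t - lam t *: w j.+1 - (j.+1%:R * lam (d t)) *: w j \in V j.
  elim: j t => [|j IH] t Pt.
    rewrite mul1r [w 1]wS -mulmxA -[X *m S t](subrK (S t *m X)) XS //.
    rewrite mulmxDr !mulmxA !vS //; last exact: Pd.
    by rewrite -scalemxAl addrK subrr mem0v.
  have -> : w j.+2 *m S t - lam t *: w j.+2 - (j.+2%:R * lam (d t)) *: w j.+1 =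
     (w j.+1 *m S t - lam t *: w j.+1 - (j.+1%:R * lam (d t)) *: w j) *m X
     + (w j.+1 *m S (d t) - lam (d t) *: w j.+1).
    rewrite -XS // mulmxBr !mulmxBl -!scalemxAl !mulmxA -!wS.
    move: (w j.+1 *m S t *m X) (w j.+2 *m S t) (w j.+2) (w j.+1) => p q r u.
    by apply/rowP => i; rewrite !mxE -[j.+2%:R]natr1; ring.
  apply: rpredD; first exact/VX/IH.
  exact/key/Pd.
have exr : exists r, w r \in V r.
  have [|nex] := boolP [exists j : 'I_n.+1, w j \in V j].
    by case/existsP=> j wj; exists j.
  have dV j : (j <= n.+1)%N -> (j <= \dim (V j))%N.
    elim: j => // j IH jn; apply: leq_ltn_trans (IH (ltnW jn)) _.
    rewrite ltnNge; apply: contra nex => le.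
    apply/existsP; exists (Ordinal jn) => /=.
    have /eqP -> : V j == V j.+1 by rewrite eqEdim le VS addvSl.
    exact: wV.
  have := dV n.+1 (leqnn _); have := dimvS (subvf (V n.+1)).
  rewrite dimvf /dim /= mul1n => h1 h2.
  by have := leq_ltn_trans h1 h2; rewrite ltnn.
case: (ex_minnP exr) => [[|r] wr minr] t Pt.
  by move: wr; rewrite memv0 (negPf v0).
have nw : w r \notin V r by apply/negP => /minr; rewrite ltnn.
have eqV u : u \in V r.+1 -> u *m S t - lam t *: u \in V r.
  suff low j z : (j <= r.+1)%N -> z \in V j -> z *m S t - lam t *: z \in V r.
    exact: low (leqnn _).
  elim: j z => [|j IH] z jr.
    by rewrite memv0 => /eqP ->; rewrite mul0mx scaler0 subrr mem0v.
  rewrite VS => /memv_addP[a aV [b /vlineP[c ->] ->]].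
  have -> : (a + c *: w j) *m S t - lam t *: (a + c *: w j) =
      (a *m S t - lam t *: a) + c *: (w j *m S t - lam t *: w j).
    rewrite mulmxDl -scalemxAl; move: (a *m S t) (w j *m S t) => p q.
    by apply/rowP => i; rewrite !mxE; ring.
  apply: rpredD; first by apply: IH => //; apply: ltnW.
  apply: memvZ.
  rewrite ltnS in jr; rewrite -(subnK jr).
  by elim: (r - j)%N => [|i IHi]; rewrite ?key // addSn sub.
have := memvB (eqV _ wr) (key2 r t Pt); rewrite subKr => h.
apply/eqP; apply: contraNT nw => nz.
move: (memvZ (r.+1%:R * lam (d t))^-1 h); rewrite scalerA mulVf ?scale1r //.
by rewrite mulf_neq0 // pnatr_eq0.
Qed.

End Lie.

Section Lie.
Variables (C : numClosedFieldType) (L : vectType C) (br : {bilinear L -> L -> L}).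

Definition right_rep n (rho : 'Hom(L, 'M[C]_n)) :=
  forall x y, rho (br x y) = rho x *m rho y - rho y *m rho x.

(** Induction on the derived length. The weight space W of [U, U] is U-stable by
    [weight_bracket_eq0]. On W each commutator of operators from U is a scalar, of trace 0, hence
    zero; so U acts on W by commuting operators, which have a common eigenvector. *)
Lemma lie_eigenvector n (rho : 'Hom(L, 'M[C]_n)) m (U : {vspace L}) :
  (0 < n)%N -> right_rep rho ->
  (brv br U U <= U)%VS -> derived_series br U m = 0%VS ->
  exists2 v : 'rV[C]_n, v != 0 & forall x, x \in U -> exists c, v *m rho x = c *: v.
Proof.
move=> n0 rhoM; elim: m U => [|m IH] U sU; first move=> /= ->.
  exists (const_mx 1).
    by apply/eqP => /rowP/(_ (Ordinal n0))/eqP; rewrite !mxE oner_eq0.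
  by move=> x; rewrite memv0 => /eqP ->; exists 0; rewrite linear0 mulmx0 scale0r.
rewrite derived_seriesS; set U' := brv br U U => dU'.
have [v v0 vU] := IH U' (brvS br sU sU) dU'.
have [i vi0] : exists i, v 0 i != 0 by apply/rV0Pn.
pose lam x := (v *m rho x) 0 i / v 0 i.
have lamE u : u \in U' -> v *m rho u = lam u *: v.
  by move=> /vU[c h]; rewrite /lam h mxE mulfK.
pose X := vbasis U'.
pose W := (\bigcap_(j < \dim U') eigenspace (rho X`_j) (lam X`_j))%MS.
have Wu u : u \in U' -> W *m rho u = lam u *: W.
  move=> uU; have lamu : lam u = \sum_j coord X j u * lam X`_j.
    rewrite {1}(coord_vbasis uU) /lam linear_sum mulmx_sumr summxE mulr_suml.
    by apply: eq_bigr => j _; rewrite linearZ -scalemxAr mxE mulrA.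
  rewrite lamu {1}(coord_vbasis uU) linear_sum mulmx_sumr scaler_suml.
  apply: eq_bigr => j _; rewrite linearZ -scalemxAr -scalerA; congr (_ *: _).
  by apply/eigenspaceP; apply: (bigcapmx_inf j).
have vW : (v <= W)%MS.
  apply/sub_bigcapmxP => j _; apply/eigenspaceP/lamE/vbasis_mem/mem_nth.
  by rewrite size_tuple.
have dU x u : x \in U -> u \in U' -> br x u \in U'.
  by move=> xU uU; apply: mem_brv => //; apply: (subvP sU).
have lam0 x u : x \in U -> u \in U' -> lam (br x u) = 0.
  move=> xU; apply: (@weight_bracket_eq0 _ _ L (fun u => u \in U') (br x) rho lam (rho x) v) => //.
  - by move=> t; apply: dU.
have WX x : x \in U -> (W *m rho x <= W)%MS.
  move=> xU; apply/sub_bigcapmxP => j _; apply/eigenspaceP.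
  have jU : X`_j \in U' by apply/vbasis_mem/mem_nth; rewrite size_tuple.
  rewrite -mulmxA -[rho x *m _](subrK (rho X`_j *m rho x)) -rhoM mulmxDr.
  by rewrite Wu ?dU // lam0 // scale0r add0r mulmxA Wu // scalemxAl.
(* B carries W as the row space of a full-rank matrix; A x is the matrix of rho x on W. *)
have [B Bfree BW0] : exists2 B : 'M_(\rank W, n), row_free B & (B :=: W)%MS.
  by exists (row_base W); [exact: row_base_free | exact: eq_row_base].
have [A AB] : exists A : L -> 'M_(\rank W), forall x, x \in U -> A x *m B = B *m rho x.
  exists (fun x => B *m rho x *m pinvmx B) => x xU.
  apply: mulmxKpV; rewrite BW0 (eqmxMr _ BW0).
  exact: WX.
have BW u : u \in U' -> B *m rho u = lam u *: B.
  have /submxP[D ->] : (B <= W)%MS by rewrite BW0.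
  by move=> uU; rewrite -mulmxA Wu // scalemxAr.
have W0 : W != 0 by apply/eqP => h; rewrite h submx0 (negPf v0) in vW.
have r0 : (0 < \rank W)%N by rewrite lt0n mxrank_eq0.
have Acomm x y : x \in U -> y \in U -> A x *m A y = A y *m A x.
  move=> xU yU; have xy : br x y \in U' by apply: mem_brv.
  have h : A x *m A y - A y *m A x = (lam (br x y))%:M.
    apply: (row_free_inj Bfree).
    rewrite mulmxBl -!mulmxA !AB // !mulmxA !AB // -!mulmxA -mulmxBr -rhoM.
    by rewrite BW // mul_scalar_mx.
  have /eqP := congr1 mxtrace h.
  rewrite linearB /= mxtrace_mulC subrr mxtrace_scalar eq_sym mulrn_eq0 gtn_eqF //=.
  by move=> /eqP l0; apply/eqP; rewrite -subr_eq0 h l0 raddf0.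
pose As := [seq A x | x <- vbasis U].
have [|z z0 /allP zA] := @common_eigenvector C _ As r0.
  by move=> _ _ /mapP[x xU ->] /mapP[y yU ->]; apply: Acomm; apply: vbasis_mem.
exists (z *m B).
  by apply: contra z0 => /eqP h; apply/eqP/(row_free_inj Bfree); rewrite mul0mx.
move=> x xU; suff /sub_rVP : (z *m B *m rho x <= z *m B)%MS by [].
rewrite (coord_vbasis xU) linear_sum mulmx_sumr; apply: summx_sub => j _.
rewrite linearZ -scalemxAr; apply: scalemx_sub.
have jU : (vbasis U)`_j \in vbasis U by rewrite mem_nth ?size_tuple.
rewrite -mulmxA -AB ?vbasis_mem // mulmxA; apply: submxMr.
exact: (zA _ (map_f A jU)).
Qed.

(** The common eigenvector, completed to a basis, splits off a one-dimensional block; the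
    complementary diagonal block is again a representation. *)
Lemma lie_trigonalization n (rho : 'Hom(L, 'M[C]_n)) :
  right_rep rho -> solvable br fullv ->
  exists2 P : 'M[C]_n, P \in unitmx & forall x, is_trig_mx (P *m rho x *m invmx P).
Proof.
move=> rhoM [m sol]; elim: n rho rhoM => [|n IH] rho rhoM.
  by exists 1%:M; [exact: unitmx1 | move=> x; apply/is_trig_mxP => -[]].
have [v v0 vx] := lie_eigenvector (ltn0Sn n) rhoM (subvf _) sol.
pose P1 := row_ebase v; pose Q1 := invmx P1.
have P1u : P1 \in unitmx by apply: row_ebase_unit.
(* The extended row base of a single row v has a nonzero multiple of v as its first row. *)
have [a a0 vP1] : exists2 a, a != 0 & v = a *: row 0 P1.
  exists (col_ebase v 0 0).
    apply: contra v0 => /eqP h; rewrite -(mulmx_ebase v) [col_ebase v]mx11_scalar h.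
    by rewrite raddf0 !mul0mx.
  rewrite -{1}(mulmx_ebase v) {1}[col_ebase v]mx11_scalar -mulmxA mul_scalar_mx.
  congr (_ *: _); apply/rowP => j; rewrite rank_rV v0 !mxE big_ord_recl big1.
    by rewrite addr0 !mxE eqxx mul1r.
  by move=> k _; rewrite !mxE /= mul0r.
have rowP1 x : exists c, row 0 P1 *m rho x = c *: row 0 P1.
  have [c] := vx x (memvf x); rewrite vP1 -scalemxAl scalerA mulrC -scalerA => /(scalerI a0) h.
  by exists c.
pose R x : 'M_(1 + n) := P1 *m rho x *m Q1.
have Rur x : ursubmx (R x) = 0.
  have [c h] := rowP1 x.
  have hR : row 0 (R x) = c *: row 0 1%:M by rewrite !row_mul h -scalemxAl -row_mul mulmxV.
  apply/rowP => j; rewrite [RHS]mxE.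
  have := congr1 (fun u : 'rV_(1 + n) => u 0 (rshift 1 j)) hR.
  rewrite [LHS]mxE [RHS]mxE [row 0 1%:M _ _]mxE [1%:M _ _]mxE mulr0 => <-.
  by rewrite [LHS]mxE [LHS]mxE; congr (R x _ _); apply/val_inj.
have RM (x y : L) : R (br x y) = R x *m R y - R y *m R x.
  by rewrite /R rhoM mulmxBr mulmxBl !mulmxA !(mulmxKV P1u).
have Rlin : linear (fun x => @drsubmx C 1 n 1 n (R x)).
  move=> b x y; rewrite /R linearP /= mulmxDr mulmxDl -scalemxAr -scalemxAl.
  move: (P1 *m rho x *m Q1) (P1 *m rho y *m Q1) => p q.
  by apply/matrixP => i j; rewrite !mxE.
pose Rl : {linear L -> 'M[C]_n} := HB.pack (fun x => @drsubmx C 1 n 1 n (R x))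
  (GRing.isLinear.Build _ _ _ _ _ Rlin).
pose rho' : 'Hom(L, 'M[C]_n) := linfun Rl.
have rho'E x : rho' x = drsubmx (R x) by rewrite lfunE.
have Rblock x : R x = block_mx (ulsubmx (R x)) 0 (dlsubmx (R x)) (rho' x).
  by rewrite rho'E -(Rur x) submxK.
have rho'M : right_rep rho'.
  have mulR x y : drsubmx (R x *m R y) = rho' x *m rho' y.
    by rewrite (Rblock x) (Rblock y) mulmx_block block_mxKdr mulmx0 add0r.
  move=> x y; rewrite -!mulR rho'E RM.
  by move: (R x *m R y) (R y *m R x) => p q; apply/matrixP => i j; rewrite !mxE.
have [P2 P2u trigP2] := IH _ rho'M.
pose P3 : 'M_(1 + n) := block_mx 1%:M 0 0 P2.
pose Q3 : 'M_(1 + n) := block_mx 1%:M 0 0 (invmx P2).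
have PQ3 : P3 *m Q3 = 1%:M.
  by rewrite mulmx_block !(mul1mx, mulmx0, mul0mx, addr0, add0r) mulmxV // -scalar_mx_block.
have PQ : (P3 *m P1) *m (Q1 *m Q3) = 1%:M by rewrite mulmxA (mulmxK P1u).
have [Pu _] := mulmx1_unit PQ.
exists (P3 *m P1 : 'M_n.+1) => // x.
have -> : P3 *m P1 *m rho x *m invmx (P3 *m P1) = P3 *m R x *m Q3.
  by rewrite -[invmx _]mulmx1 -PQ (mulKmx Pu) /R !mulmxA.
rewrite Rblock !mulmx_block !(mul1mx, mulmx0, mul0mx, mulmx1, addr0, add0r).
by rewrite (@is_trig_block_mx _ 1 n 1 n) // eqxx trigP2 andbT mx11_is_trig.
Qed.
End Lie.

(** * The nilradical of a solvable algebra *)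

Section Solvable.
Variables (C : numClosedFieldType) (L : vectType C) (br : {bilinear L -> L -> L}).
Hypothesis hL : leibniz_identity br.

Lemma trig_mul_diag n (A B : 'M[C]_n) i :
  is_trig_mx A -> is_trig_mx B -> (A *m B) i i = A i i * B i i.
Proof.
move=> /is_trig_mxP tA /is_trig_mxP tB; rewrite mxE (bigD1 i) //= big1 ?addr0 //.
move=> j ji; case: (ltngtP i j) => [ij|ij|/val_inj e]; last by rewrite e eqxx in ji.
  by rewrite tA ?mul0r.
by rewrite tB ?mulr0.
Qed.

(** Lie's theorem for the right regular representation, stated in coordinates [c] adapted to an
    invariant flag. *)
Lemma right_mult_trigonal : solvable br fullv ->
  exists n (c : L -> 'rV[C]_n) (T : L -> 'M[C]_n),
    [/\ linear c, bijective c, linear T, forall x, is_trig_mx (T x) &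
       forall v x, c (br v x) = c v *m T x].
Proof.
move=> sol; pose e := vbasis (fullv : {vspace L}).
have ef : basis_of fullv e by apply: vbasisP.
have rl : linear (fun x => mxof e e (radm br x)).
  move=> a x y; rewrite -linearP; congr mxof; apply/lfunP => v.
  by rewrite add_lfunE scale_lfunE !radmE linearP.
pose rho := hom_of_linear rl.
have rhoE v x : rVof e (br v x) = rVof e v *m rho x.
  by rewrite hom_of_linearE -radmE (rVof_app e ef).
have rhoM : right_rep br rho.
  move=> x y; apply/row_matrixP => i; rewrite !rowE.
  rewrite -(rVofE ef) -rhoE mulmxBr !mulmxA -!rhoE -linearB /= hL.
  by rewrite [X in X - _]addrC addrK.
have [P Pu tP] := lie_trigonalization rhoM sol.
exists _, (fun v => rVof e v *m invmx P), (fun x => P *m rho x *m invmx P); split=> //.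
- by move=> a x y; rewrite linearP mulmxDl -scalemxAl.
- exists (fun u => vecof e (u *m P)) => [v|u].
    by rewrite (mulmxKV Pu) rVofK.
  by rewrite vecofK // (mulmxK Pu).
- by move=> a x y; rewrite linearP mulmxDr mulmxDl -scalemxAr -scalemxAl.
- by move=> v x; rewrite rhoE !mulmxA (mulmxKV Pu).
Qed.

Section Nilradical.
Variable N : {vspace L}.
Hypotheses (hsolv : solvable br fullv) (hN : nilradical br N).

(** Both facts come from one ideal, the common kernel K of the diagonal characters of the
    triangularised right multiplications. Characters vanish on brackets, so K contains [R, R]; and
    right multiplication by K is strictly triangular, so the lower central series of K reaches 0. *)
Lemma nilradical_criterion :
  (forall x y, br x y \in N) /\
  (forall x, (forall v, exists t, iter t (radm br x) v = 0) -> x \in N).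
Proof.
have [n [c [T [cl [c' cK c'K] Tl Tt cT]]]] := right_mult_trigonal hsolv.
have mul : linear (fun x => \row_i T x i i).
  by move=> a x y; apply/rowP => i; rewrite !mxE Tl !mxE.
pose K := lker (hom_of_linear mul).
have memK x : reflect (forall i, T x i i = 0) (x \in K).
  rewrite memv_ker hom_of_linearE; apply: (iffP eqP) => [/rowP h i|h].
    by have := h i; rewrite !mxE.
  by apply/rowP => i; rewrite !mxE h.
have c0 : c 0 = 0 by have := cl (-1) 0 0; rewrite !scaleN1r oppr0 addr0 addNr.
have cinj x : c x = 0 -> x = 0 by move=> cx; apply: (can_inj cK); rewrite cx c0.
have TM x y : T (br x y) = T x *m T y - T y *m T x.
  apply/row_matrixP => i; rewrite !rowE; rewrite -[delta_mx _ _]c'K.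
  rewrite mulmxBr !mulmxA -!cT [in RHS]hL.
  have -> u v : c (u + v) = c u + c v by rewrite -[u]scale1r cl !scale1r.
  by rewrite [X in X - _]addrC addrK.
have brK x y : br x y \in K.
  apply/memK => i; rewrite TM.
  have -> (A B : 'M[C]_n) : (A - B) i i = A i i - B i i by rewrite !mxE.
  by rewrite !trig_mul_diag // mulrC subrr.
have Kid : ideal br fullv K.
  by split; [exact: subvf | apply: brv_subP..] => u v _ _; apply: brK.
(* The flag: c v has support in the first n - m coordinates. *)
pose g m := fun v => \row_(i < n) if (n - m <= i)%N then c v 0 i else 0.
have gl m : linear (g m).
  move=> a x y; apply/rowP => i; rewrite !mxE; case: ifP => _; last by rewrite mulr0 addr0.
  by rewrite cl !mxE.
have memW m v : reflect (forall i : 'I_n, (n - m <= i)%N -> c v 0 i = 0)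
      (v \in lker (hom_of_linear (gl m))).
  rewrite memv_ker hom_of_linearE; apply: (iffP eqP) => [/rowP h i ni|h].
    by have := h i; rewrite !mxE ni.
  by apply/rowP => i; rewrite !mxE; case: ifP => // /h.
have KW m : (lower_central br K m <= lker (hom_of_linear (gl m)))%VS.
  elim: m => [|m IH] /=.
    by apply/subvP => v _; apply/memW => i; rewrite subn0 leqNgt ltn_ord.
  apply: brv_subP => u v /(subvP IH)/memW uW /memK vK; apply/memW => i ni.
  rewrite cT mxE big1 // => j _; case: (ltngtP i j) => [ij|ij|/val_inj <-].
  - rewrite uW ?mul0r //; move: ni ij; rewrite !leq_subLR addSn => ni ij.
    by apply: leq_trans ni _; rewrite -addnS leq_add2l.
  - by have /is_trig_mxP -> := Tt v; rewrite ?mulr0.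
  - by rewrite vK mulr0.
have Knil : nilpotent br K.
  exists n; apply/eqP; rewrite -subv0; apply/subvP => v /(subvP (KW n))/memW h.
  rewrite memv0; apply/eqP/cinj/rowP => i; rewrite mxE h //.
  by rewrite subnn.
have KN : (K <= N)%VS by case: hN => _ _; apply.
split=> [x y|x xnil]; first exact: (subvP KN).
apply: (subvP KN); apply/memK => i.
have : eigenvalue (T x) (T x i i).
  rewrite eigenvalue_root_char char_poly_trig // /root horner_prod.
  by apply/prodf_eq0; exists i => //; rewrite hornerXsubC subrr.
move=> /eigenvalueP[u uT u0].
have [t ht] := xnil (c' u).
have : T x i i ^+ t *: c' u = 0.
  rewrite -{}[RHS]ht; elim: t => [|t /= <-]; first by rewrite scale1r.
  rewrite linearZ /= radmE exprSr -scalerA; congr (_ *: _).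
  apply: (can_inj cK); rewrite cT c'K uT.
  by rewrite -[X in c X]addr0 cl c0 addr0 c'K.
move=> /eqP; rewrite scaler_eq0 => /orP[|/eqP h]; first by rewrite expf_eq0 => /andP[_ /eqP].
by move: u0; rewrite -[u]c'K h c0 eqxx.
Qed.

End Nilradical.
End Solvable.

(** * The lower central series and a coordinate map on N / N^2 *)

Section QuotientCoord.
Variables (F : fieldType) (L : vectType F).

(** The section [s] turns operators of N that preserve M into matrices on [N / M]. *)
Lemma quotient_coord k (M N : {vspace L}) : (M <= N)%VS -> \dim N = (\dim M + k)%N ->
  exists (q : 'Hom(L, 'rV[F]_k)) (s : 'Hom('rV[F]_k, L)),
    [/\ forall r, s r \in N, forall r, q (s r) = r &
        forall v, v \in N -> (q v == 0) = (v \in M)].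
Proof.
move=> MN dN; have ek : k = \dim (N :\: M).
  by apply/(@addnI (\dim M)); rewrite -dN -(dimv_cap_compl N M) (capv_idPr MN).
have NGM : N = (N :\: M + M)%VS by rewrite addv_diff (addv_idPl MN).
have GM0 : ((N :\: M) :&: M)%VS = 0%VS by apply: capv_diff.
rewrite {dN}ek; move: (N :\: M)%VS NGM GM0 => G NGM GM0.
pose X := vbasis G; have Xfree : free X by apply: basis_free (vbasisP _).
have ql : linear (fun v => \row_i coord X i (daddv_pi G M v)).
  by move=> a x y; apply/rowP => i; rewrite !mxE !linearP.
have sl : linear (fun r : 'rV[F]_(\dim G) => \sum_i r 0 i *: X`_i).
  move=> a x y; under eq_bigr do rewrite !mxE scalerDl -scalerA.
  by rewrite big_split /= scaler_sumr.
have sG (r : 'rV[F]_(\dim G)) : \sum_i r 0 i *: X`_i \in G.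
  by apply: memv_suml => i _; apply/memvZ/vbasis_mem/mem_nth; rewrite size_tuple.
exists (hom_of_linear ql), (hom_of_linear sl); split=> [r|r|v vN].
- by rewrite hom_of_linearE NGM; apply: (subvP (addvSl _ _)).
- rewrite !hom_of_linearE; apply/rowP => i; rewrite !mxE daddv_pi_id //.
  by rewrite coord_sum_free.
- have pvM : v - daddv_pi G M v \in M.
    rewrite NGM in vN; rewrite -{1}(daddv_pi_add GM0 vN) [X in X - _]addrC addrK.
    exact: memv_pi.
  rewrite hom_of_linearE; apply/eqP/idP => [/rowP h|vM].
    suff p0 : daddv_pi G M v = 0 by move: pvM; rewrite p0 subr0.
    rewrite (coord_vbasis (memv_pi G M v)) big1 // => i _.
    by have := h i; rewrite !mxE => ->; rewrite scale0r.
  have : daddv_pi G M v \in (G :&: M)%VS.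
    by rewrite memv_cap memv_pi /= -(subKr v (daddv_pi G M v)) memvB.
  by rewrite GM0 memv0 => /eqP ->; apply/rowP => i; rewrite !mxE linear0.
Qed.

(** [f] maps the larger space A into B and is injective on B, hence bijective on B: so
    [A = B + ker f]. *)
Lemma injective_complement (f : 'End(L)) (A B : {vspace L}) :
  (B <= A)%VS -> (forall v, v \in A -> f v \in B) ->
  (forall v, v \in B -> f v = 0 -> v = 0) ->
  forall v, v \in A -> exists2 b, b \in B & f (v - b) = 0.
Proof.
move=> BA fA finj v vA.
have fB : (f @: B)%VS = B.
  apply/eqP; rewrite eqEdim; apply/andP; split.
    by apply/subvP => _ /memv_imgP[u uB ->]; apply/fA/(subvP BA).
  rewrite limg_dim_eq //; apply/eqP; rewrite -subv0; apply/subvP => u.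
  by rewrite memv_cap memv_ker memv0 => /andP[uB /eqP /finj ->].
have := fA v vA; rewrite -{1}fB => /memv_imgP[b bB fb].
by exists b; rewrite ?linearB /= ?fb ?subrr.
Qed.

End QuotientCoord.

Section LowerCentral.
Variables (F : fieldType) (L : vectType F) (br : {bilinear L -> L -> L}).
Hypothesis hL : leibniz_identity br.
Variable N : {vspace L}.
Let LC := lower_central br N.

Lemma brNK u v w : br u (br v w) = br (br u v) w - br (br u w) v.
Proof. by rewrite [in RHS]hL addrC addKr. Qed.

Lemma lower_central_br m a b : a \in LC m -> b \in N -> br a b \in LC m.+1.
Proof. exact: mem_brv. Qed.

Hypothesis Nsub : (brv br N N <= N)%VS.

Lemma lower_centralS m : (LC m.+1 <= LC m)%VS.
Proof. by elim: m => [//|m IH] /=; apply: brvS. Qed.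

Lemma lower_central_brSS m a b :
  a \in LC m -> b \in brv br N N -> br a b \in LC m.+2.
Proof.
move=> aL; suff /subvP h : (brv br N N <= ladm br a @^-1: LC m.+2)%VS.
  by move=> /h; rewrite -memv_preim ladmE.
apply: brv_subP => u v uN vN; rewrite -memv_preim ladmE brNK.
by rewrite memvB // lower_central_br // lower_central_br.
Qed.

Lemma lower_central_radm x m v :
  (forall u, u \in N -> br u x \in N) -> v \in LC m -> br v x \in LC m.
Proof.
move=> Nx; elim: m v => [|m IH] v; first exact: Nx.
suff /subvP h : (LC m.+1 <= radm br x @^-1: LC m.+1)%VS.
  by move=> /h; rewrite -memv_preim radmE.
apply: brv_subP => a b aL bN; rewrite -memv_preim radmE hL.
by rewrite memvD // lower_central_br ?IH ?Nx.
Qed.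

(** Nilpotency on N / N^2 propagates down the lower central series, because right multiplication
    by [x] is a derivation: on a product, [p + t'] applications put either [p] of them on the first
    factor or [t'] on the second. *)
Lemma iter_radm_lower_central x t :
  (forall u, u \in N -> br u x \in N) ->
  (forall v, v \in N -> iter t (radm br x) v \in LC 1) ->
  forall m v, v \in LC m -> iter (m.+1 * t) (radm br x) v \in LC m.+1.
Proof.
move=> Nx nil.
have stab m p v : v \in LC m -> iter p (radm br x) v \in LC m.
  by move=> vL; elim: p => //= p IH; rewrite radmE lower_central_radm.
have prod m p t' a b : a \in LC m -> b \in N -> iter p (radm br x) a \in LC m.+1 ->
    iter t' (radm br x) b \in LC 1 -> iter (p + t') (radm br x) (br a b) \in LC m.+2.
  move E : (p + t')%N => n; elim: n p t' E a b => [|n IH] [|p] [|t'] // E a b aL bN ha hb.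
  - by apply: lower_central_br.
  - by apply/stab/lower_central_br.
  - by apply/stab/lower_central_brSS.
  rewrite iterSr radmE hL; set f := iter n _.
  have fD u v : f (u + v) = f u + f v.
    by rewrite /f; elim: (n) => //= n' ->; rewrite linearD.
  rewrite fD memvD //.
    apply: (IH p t'.+1) => //; first by case: E.
      exact: lower_central_radm.
    by rewrite -radmE -iterSr.
  apply: (IH p.+1 t') => //; first by case: E => <-; rewrite addSnnS.
    exact: Nx.
  by rewrite -radmE -iterSr.
elim=> [|m IH] v; first by rewrite mul1n; apply: nil.
pose g := iter (m.+2 * t) (comp_lfun (radm br x)) \1%VF.
have gE u : g u = iter (m.+2 * t) (radm br x) u.
  by rewrite /g; elim: (m.+2 * t)%N => [|n IHn] /=; rewrite ?id_lfunE ?comp_lfunE ?IHn.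
suff /subvP h : (LC m.+1 <= g @^-1: LC m.+2)%VS by move=> /h; rewrite -memv_preim gE.
apply: brv_subP => a b aL bN; rewrite -memv_preim gE mulSn addnC.
by apply: prod => //; [exact: IH | exact: nil].
Qed.

End LowerCentral.

(** * Words in the generators *)

Section SpanOrd.
Variables (F : fieldType) (L : vectType F) (k : nat) (e : 'I_k -> L).

Lemma span_ordP v :
  v \in <<[seq e i | i : 'I_k]>>%VS <-> exists a : 'I_k -> F, v = \sum_i a i *: e i.
Proof.
split=> [|[a ->]]; last first.
  by apply: memv_suml => i _; apply/memvZ/memv_span/image_f.
have -> : [seq e i | i : 'I_k] = mktuple e by [].
move=> /coord_span ->; exists (coord (mktuple e) ^~ v).
by apply: eq_bigr => i _; rewrite -tnth_nth tnth_mktuple.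
Qed.

Lemma free_ordP :
  free [seq e i | i : 'I_k] <->
  (forall a : 'I_k -> F, \sum_i a i *: e i = 0 -> forall i, a i = 0).
Proof.
have -> : [seq e i | i : 'I_k] = mktuple e by [].
have E (a : 'I_k -> F) : \sum_i a i *: (mktuple e)`_i = \sum_i a i *: e i.
  by apply: eq_bigr => i _; rewrite -tnth_nth tnth_mktuple.
by split=> [/freeP h a|h]; [rewrite -E; apply: h | apply/freeP => a; rewrite E; apply: h].
Qed.

Lemma eigen_coord (X : k.-tuple L) (D : 'End(L)) (w : 'I_k -> F) (c : F) v :
  free X -> (forall i : 'I_k, D X`_i = w i *: X`_i) -> v \in <<X>>%VS -> D v = c *: v ->
  forall i, coord X i v != 0 -> w i = c.
Proof.
move=> Xfree DX vX Dv i vi0; apply: (mulIf vi0).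
have := congr1 (coord X i) Dv; rewrite linearZ /= => <-.
rewrite {2}(coord_span vX) linear_sum /=.
under eq_bigr do rewrite linearZ /= DX scalerA mulrC.
by rewrite coord_sum_free.
Qed.

End SpanOrd.

Section Words.
Variables (F : fieldType) (L : vectType F) (br : {bilinear L -> L -> L}) (N : {vspace L}).
Variables (k : nat) (e : 'I_k -> L).

Local Notation word := (iter_bracket br).

Lemma iter_bracket_rcons p j : p != [::] ->
  word e (rcons p j) = br (word e p) (e j).
Proof. by case: p => //= i p _; rewrite foldl_rcons. Qed.

Lemma word_ind (P : seq 'I_k -> Prop) :
  (forall i, P [:: i]) -> (forall p i, p != [::] -> P p -> P (rcons p i)) ->
  forall p, p != [::] -> P p.
Proof.
move=> P1 PS; elim/last_ind => // p i IH _.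
by case: (eqVneq p [::]) => [->|p0]; [apply: P1 | apply: PS => //; apply: IH].
Qed.

(** Generation phrased by subspaces that contain the generators and are stable under right
    multiplication by them. By the Leibniz identity left-normed words suffice to span the generated
    subalgebra, so these subspaces are the ones to test. *)
Definition generates :=
  (forall i, e i \in N) /\
  forall S : {vspace L}, (forall i, e i \in S) ->
    (forall u i, u \in N -> u \in S -> br u (e i) \in S) -> (N <= S)%VS.

Hypothesis Nsub : (brv br N N <= N)%VS.

Lemma brvN u v : u \in N -> v \in N -> br u v \in N.
Proof. by move=> uN vN; apply/(subvP Nsub)/mem_brv. Qed.

Lemma word_mem p : (forall i, e i \in N) -> p != [::] -> word e p \in N.
Proof.
move=> eN; elim/word_ind: p / => [i|p i p0 IH]; first exact: eN.
by rewrite iter_bracket_rcons // brvN.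
Qed.

Lemma word_mem_brv p : (forall i, e i \in N) -> (1 < size p)%N -> word e p \in brv br N N.
Proof.
move=> eN; case/lastP: p => // p i; rewrite size_rcons ltnS lt0n size_eq0 => p0.
by rewrite iter_bracket_rcons // mem_brv // word_mem.
Qed.

(** If the chosen words do not span N, then some generator, or some chosen word followed by one
    more letter, lies outside their span; only finitely many candidates need to be examined. *)
Lemma word_basis_extend (W0 : seq (seq 'I_k)) :
  generates -> [::] \notin W0 -> free [seq word e p | p <- W0] ->
  exists W1, [::] \notin W1 /\ basis_of N [seq word e p | p <- W0 ++ W1].
Proof.
move=> [eN gen]; move E : (\dim N - size W0)%N => n.
elim: n W0 E => [|n IH] W0 E W0n Wfree.
  exists [::]; split=> //; rewrite cats0 basisEfree Wfree size_map /= andbC -subn_eq0 E eqxx /=.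
  by apply/span_subvP => _ /mapP[p pW ->]; rewrite word_mem //; apply: contra W0n => /eqP <-.
set S := <<[seq word e p | p <- W0]>>%VS.
have [NS|nNS] := boolP (N <= S)%VS.
  exists [::]; split=> //; rewrite cats0 basisEdim NS /= size_map.
  move: Wfree; rewrite /free size_map => /eqP <-; apply/dimvS/span_subvP => _ /mapP[p pW ->].
  by rewrite word_mem //; apply: contra W0n => /eqP <-.
have [p p0 pS] : exists2 p, p != [::] & word e p \notin S.
  have [/existsP[i iS]|/existsPn h1] := boolP [exists i, e i \notin S]; first by exists [:: i].
  have [/hasP[p pW /existsP[i iS]]|/hasPn h2] :=
    boolP (has (fun p => [exists i, br (word e p) (e i) \notin S]) W0).
    have p0 : p != [::] by apply: contra W0n => /eqP <-.
    by exists (rcons p i); [case: (p) | rewrite iter_bracket_rcons].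
  case/negP: nNS; apply: gen => [i|u i _ uS]; first by rewrite -[_ \in _]negbK h1.
  have /subvP h : (S <= radm br (e i) @^-1: S)%VS.
    apply/span_subvP => _ /mapP[p pW ->]; rewrite -memv_preim radmE.
    by have /existsPn/(_ i) := h2 p pW; rewrite negbK.
  by rewrite -radmE memv_preim h.
have [|||W1 [W1n W1b]] := IH (rcons W0 p).
- by rewrite size_rcons subnS E.
- by rewrite mem_rcons inE negb_or eq_sym p0.
- rewrite map_rcons -cats1 (perm_free (permEl (perm_catC _ _))) /= free_cons.
  by rewrite Wfree andbT.
exists (p :: W1); split; first by rewrite inE negb_or eq_sym p0.
by rewrite -cat_rcons.
Qed.

Lemma weight_word (D : 'End(L)) (w : 'I_k -> F) :
  (forall u v, u \in N -> v \in N -> D (br u v) = br (D u) v + br u (D v)) ->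
  (forall i, e i \in N) -> (forall i, D (e i) = w i *: e i) ->
  forall p, p != [::] -> D (word e p) = (\sum_(j <- p) w j) *: word e p.
Proof.
move=> DM eN De p; elim/word_ind: p / => [i|p i p0 IH]; first by rewrite big_seq1 De.
rewrite iter_bracket_rcons // DM ?word_mem // IH De brZl linearZ -scalerDl.
by rewrite -cats1 big_cat big_seq1.
Qed.

End Words.

Section Generation.
Variables (F : fieldType) (L : vectType F) (br : {bilinear L -> L -> L}).
Hypothesis hL : leibniz_identity br.
Variables (N : {vspace L}) (k : nat) (e : 'I_k -> L).
Hypotheses (Nsub : (brv br N N <= N)%VS) (Nnil : nilpotent br N).

(** A complement of N^2 generates the nilpotent algebra N: an element of N^m is a combination of
    words up to N^(m+1), by induction on m. *)
Lemma generates_mod_square : (forall i, e i \in N) ->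
  (forall v, v \in N -> exists a : 'I_k -> F, v - \sum_i a i *: e i \in brv br N N) ->
  generates br N e.
Proof.
move=> eN emod; split=> // S eS Sbr; pose LC := lower_central br N.
have [c hc] := Nnil; pose S' := (S :&: N)%VS.
have brS' u i : u \in S' -> br u (e i) \in S'.
  by rewrite !memv_cap => /andP[uS uN]; rewrite Sbr // brvN.
have step m : (LC m <= S' + LC m.+1)%VS.
  elim: m => [|m IH].
    apply/subvP => v /emod[a h]; rewrite -(subrK (\sum_i a i *: e i) v) addrC memv_add //.
    by apply: memv_suml => i _; rewrite memvZ // memv_cap eS eN.
  apply: brv_subP => a b aL bN.
  have /memv_addP[s sS [a' a'L Ea]] := subvP IH a aL.
  have [t bt] := emod b bN; pose b1 := \sum_i t i *: e i.
  have sL : s \in LC m.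
    rewrite -(addrK a' s) -Ea memvB //; exact: (subvP (lower_centralS Nsub m)).
  have -> : br a b = br s b1 + (br s (b - b1) + br a' b).
    by rewrite Ea brDl addrA -linearD /= [b1 + _]addrC subrK.
  apply: memv_add.
    by rewrite linear_sumr; apply: memv_suml => i _; rewrite linearZ memvZ ?brS'.
  apply: memvD; first exact: (lower_central_brSS hL).
  exact: (lower_central_br a'L).
have all m : (N <= S' + LC m)%VS.
  elim: m => [|m IH]; first exact: addvSr.
  apply: subv_trans IH _; rewrite subv_add addvSl /=; exact: step.
by have := all c; rewrite /LC hc addv0 subv_cap => /andP[].
Qed.

End Generation.

(** * The diagonal complement of the nilradical and its table *)

(** The eigenvectors of a triangular matrix with distinct diagonal entries form a basis, and a
    matrix commuting with it preserves each of the lines they span. *)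
Lemma trig_simple_spectrum (F : fieldType) k (A : 'M[F]_k) :
  is_trig_mx A -> injective (fun i => A i i) ->
  exists2 U : 'M[F]_k, U \in unitmx &
    forall B, A *m B = B *m A -> is_diag_mx (U *m B *m invmx U).
Proof.
move=> tA injA; pose d i := A i i.
have /all_sig2[u uA u0] : forall i, {u : 'rV[F]_k | u *m A = d i *: u & u != 0}.
  move=> i.
  suff /sig2W[v /eqP vA v0] : exists2 v : 'rV_k, v *m A == d i *: v & v != 0 by exists v.
  have /eigenvalueP[u uA u0] : eigenvalue A (d i).
    rewrite eigenvalue_root_char char_poly_trig // /root horner_prod.
    by apply/prodf_eq0; exists i => //; rewrite hornerXsubC subrr.
  by exists u => //; apply/eqP.
pose U := \matrix_i u i.
have UA : U *m A = diag_mx (\row_i d i) *m U.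
  apply/row_matrixP => i; rewrite row_mul rowK uA.
  by apply/rowP => j; rewrite mul_diag_mx !mxE.
have Uu : U \in unitmx.
  rewrite -row_free_unit -kermx_eq0; apply/rowV0P => r /sub_kermxP.
  rewrite mulmx_sum_row => rU; apply/rowP => i; rewrite mxE.
  have dir := @mxdirect_sum_eigenspace _ _ _ A (fun=> true) d (in2W injA).
  have [v _ _ uniq] := sub_dsumsmx dir (sub0mx 1 _).
  have h1 : v i = 0.
    by rewrite -(uniq (fun=> 0)) ?big1 // => j _; apply: sub0mx.
  have : r 0 i *: u i = v i.
    rewrite -(uniq (fun j => r 0 j *: u j)) // => [j _|].
      by apply/scalemx_sub/eigenspaceP/uA.
    by rewrite -[LHS]rU; apply: eq_bigr => j _; rewrite rowK.
  by rewrite h1 => /eqP; rewrite scaler_eq0 (negPf (u0 i)) orbF => /eqP.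
exists U => // B AB; apply/is_diag_mxP => i j ij.
have : diag_mx (\row_i d i) *m (U *m B *m invmx U) = (U *m B *m invmx U) *m diag_mx (\row_i d i).
  have -> : diag_mx (\row_i d i) = U *m A *m invmx U by rewrite UA mulmxK.
  by rewrite !mulmxA !mulmxKV // -[U *m A *m B]mulmxA AB mulmxA.
move: (U *m B *m invmx U) => B' /matrixP/(_ i j).
rewrite mul_diag_mx mul_mx_diag !mxE mulrC => /eqP.
rewrite -subr_eq0 -mulrBr mulf_eq0 subr_eq0 => /orP[/eqP //|/eqP/injA e].
by rewrite e eqxx in ij.
Qed.

Lemma sort_ord k (b : pred 'I_k) : exists (s : 'I_k -> 'I_k) (k1 : nat),
  [/\ injective s, (k1 <= k)%N & forall i, b (s i) = (i < k1)%N].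
Proof.
pose l := enum b ++ enum (predC b).
have sz : size l = k by rewrite size_cat -!cardE cardC card_ord.
have ul : uniq l.
  rewrite cat_uniq !enum_uniq andbT /=; apply/hasPn => i.
  by rewrite !mem_enum.
exists (fun i => nth i l i), #|b|; split.
- move=> i j; rewrite [nth j l j](set_nth_default i) ?sz // => /eqP.
  by rewrite nth_uniq ?sz // => /eqP/val_inj.
- by rewrite -[X in (_ <= X)%N]card_ord max_card.
move=> i; have := ltn_ord i; rewrite -{2}sz size_cat => il.
rewrite nth_cat -cardE; case: ltnP => ib.
  by have := mem_nth i (n := i) (s := enum b); rewrite -cardE => /(_ ib); rewrite mem_enum.
have : nth i (enum (predC b)) (i - #|b|) \in enum (predC b).
  by rewrite mem_nth // ltn_subLR // cardE.
by rewrite mem_enum => /negPf.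
Qed.

Lemma sum_count_size k (p : seq 'I_k) : (\sum_(l < k) count_mem l p)%N = size p.
Proof.
elim: p => [|j p IH] /=; first by rewrite big1.
by rewrite big_split /= IH (bigD1 j) //= eqxx big1 ?addn0 // => l lj; rewrite eq_sym (negPf lj).
Qed.

Lemma eq_iter_bracket (F : fieldType) (L : vectType F) (br : {bilinear L -> L -> L})
    k (g h : 'I_k -> L) p : g =1 h -> iter_bracket br g p = iter_bracket br h p.
Proof.
by move=> gh; case: p => //= i p; rewrite gh; elim: p (h i) => //= j p IH u; rewrite gh IH.
Qed.

Section Existence.
Variables (C : numClosedFieldType) (L : vectType C) (br : {bilinear L -> L -> L}).
Hypothesis hL : leibniz_identity br.
Variables (N : {vspace L}) (k : nat).
Hypotheses (hsolv : solvable br fullv) (hN : nilradical br N).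
Hypothesis dimL : \dim (fullv : {vspace L}) = (\dim N + k)%N.
Hypothesis dimN : \dim N = (\dim (brv br N N) + k)%N.

Let brN x y : br x y \in N. Proof. exact: (nilradical_criterion hL hsolv hN).1. Qed.
Let N2sub : (brv br N N <= N)%VS. Proof. by apply: brv_subP => u v _ _. Qed.

(** The triangular weights [mu] of R on N / N^2 vanish together only on N, since a strictly
    triangular action on N / N^2 makes right multiplication nilpotent. By the equality of
    dimensions [mu] is onto, so some element has the distinct weights 0, ..., k - 1, and the
    operators commuting with it are diagonal in its eigenbasis. The maps [q] and [lam] are the
    coordinates on N / N^2 in that basis and the weights. *)
Lemma weights_on_generators : exists (q lam : 'Hom(L, 'rV[C]_k)),
  [/\ forall v, v \in N -> (q v == 0) = (v \in brv br N N),
      forall r, exists2 v, v \in N & q v = r,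
      forall v x i, v \in N -> q (br v x) 0 i = q v 0 i * lam x 0 i,
      forall r, exists x, lam x = r &
      forall x, (lam x == 0) = (x \in N)].
Proof.
have [q [s [sN sK qN2]]] := quotient_coord N2sub dimN.
pose R x := lin1_mx (q \o radm br x \o s).
have RE r x : r *m R x = q (br (s r) x) by rewrite mul_rV_lin1 /= radmE.
have N2x x v : v \in brv br N N -> br v x \in brv br N N.
  by apply: (@lower_central_radm _ _ _ hL _ x 1).
have qR v x : v \in N -> q (br v x) = q v *m R x.
  move=> vN; rewrite RE; apply/eqP; rewrite -subr_eq0 -linearB -brBl /= qN2 //.
  by apply: N2x; rewrite -qN2 ?memvB // linearB /= sK subrr.
have Rl : linear R.
  move=> a x y; apply/row_matrixP => i; rewrite !rowE mulmxDr -scalemxAr !RE.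
  by rewrite !linearP.
pose rho := hom_of_linear Rl.
have rhoM : right_rep br rho.
  move=> x y; rewrite !hom_of_linearE; apply/row_matrixP => i; rewrite !rowE.
  move: (delta_mx 0 i) => r; rewrite mulmxBr !mulmxA [r *m R x]RE [r *m R y]RE -!qR //.
  by rewrite RE (brNK hL) linearB.
have R0 x : x \in N -> R x = 0.
  move=> xN; apply/row_matrixP => i; rewrite !rowE RE mulmx0; apply/eqP.
  by rewrite qN2 // mem_brv.
have Rcomm x y : R x *m R y = R y *m R x.
  apply/eqP; rewrite -subr_eq0; have := rhoM x y; rewrite !hom_of_linearE => <-.
  by rewrite R0.
have nilR x t : (forall r : 'rV_k, iter t (mulmxr (R x)) r = 0) -> x \in N.
  move=> nil; apply: (nilradical_criterion hL hsolv hN).2 => v.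
  have Nx u : u \in N -> br u x \in N by move=> _; apply: brN.
  have step w : w \in N -> iter t (radm br x) w \in brv br N N.
    move=> wN; have itN p : iter p (radm br x) w \in N.
      by elim: p => //= p IH; rewrite radmE brN.
    rewrite -qN2 //; apply/eqP; rewrite -[RHS](nil (q w)).
    by elim: (t) => //= p <-; rewrite radmE qR.
  have [_ [c hc] _] := hN.
  have down m : exists p, iter p (radm br x) (br v x) \in lower_central br N m.
    elim: m => [|m [p IH]]; first by exists 0%N; rewrite /= brN.
    exists (m.+1 * t + p)%N; rewrite iterD.
    exact: (iter_radm_lower_central hL Nx step).
  have [p] := down c; rewrite hc memv0 => /eqP h.
  by exists p.+1; rewrite iterSr radmE.
have surj (lam : 'Hom(L, 'rV[C]_k)) :
  (forall x, (lam x == 0) = (x \in N)) -> forall r, exists x, lam x = r.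
  move=> lamN r; have lamf : limg lam = fullv.
    apply/eqP; rewrite eqEdim subvf dimvf /dim /= mul1n.
    have /eqP := limg_ker_dim lam fullv; rewrite dimL capfv.
    have -> : lker lam = N by apply/vspaceP => v; rewrite memv_ker lamN.
    by rewrite eqn_add2l => /eqP ->.
  by have := memvf r; rewrite -lamf => /memv_imgP[x _ ->]; exists x.
have [P Pu tP] := lie_trigonalization rhoM hsolv.
pose T x := P *m R x *m invmx P.
have diagl (U : 'M[C]_k) : linear (fun x => \row_i (U *m R x *m invmx U) i i).
  move=> a x y; rewrite Rl mulmxDr mulmxDl -scalemxAr -scalemxAl.
  by apply/rowP => i; rewrite !mxE.
have conjR (U : 'M[C]_k) x t (r : 'rV_k) : U \in unitmx ->
    iter t (mulmxr (R x)) r = iter t (mulmxr (U *m R x *m invmx U)) (r *m invmx U) *m U.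
  move=> Uu; elim: t => [|t /= ->]; first by rewrite /= mulmxKV.
  by rewrite !mulmxA mulmxKV.
(* The weights from the triangular form; a common zero gives a strictly triangular matrix. *)
pose mu := hom_of_linear (diagl P).
have muN x : (mu x == 0) = (x \in N).
  apply/eqP/idP => [/rowP mu0|xN]; last first.
    by rewrite hom_of_linearE R0 // mulmx0 mul0mx; apply/rowP => i; rewrite !mxE.
  apply: (nilR x k) => r; rewrite (conjR P) //; apply/eqP.
  suff -> : iter k (mulmxr (P *m R x *m invmx P)) (r *m invmx P) = 0 by rewrite mul0mx.
  have tx := tP x; rewrite hom_of_linearE in tx.
  suff h m (i : 'I_k) : (k - m <= i)%N ->
      iter m (mulmxr (P *m R x *m invmx P)) (r *m invmx P) 0 i = 0.
    by apply/rowP => i; rewrite h ?mxE // subnn.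
  elim: m i => [|m IH] i ni; first by move: ni; rewrite subn0 leqNgt ltn_ord.
  rewrite /= mxE big1 // => j _; case: (ltngtP i j) => [ij|ij|/val_inj <-].
  - rewrite IH ?mul0r //; move: ni ij; rewrite !leq_subLR addSn => ni ij.
    by apply: leq_trans ni _; rewrite -addnS leq_add2l.
  - by have /is_trig_mxP -> := tx; rewrite ?mulr0.
  - by have := mu0 i; rewrite hom_of_linearE mxE [RHS]mxE => ->; rewrite mulr0.
(* An element with distinct weights diagonalises everything that commutes with it. *)
have [a ha] := surj mu muN (\row_i i%:R).
have Taii i : T a i i = i%:R by have /rowP/(_ i) := ha; rewrite hom_of_linearE !mxE.
have [] := @trig_simple_spectrum _ _ (T a).
- by have := tP a; rewrite hom_of_linearE.
- by move=> i j; rewrite !Taii => /eqP; rewrite eqr_nat => /eqP/val_inj.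
move=> U1 U1u U1d; pose U := U1 *m P.
have Uu : U \in unitmx by rewrite unitmx_mul U1u.
have Ud x : is_diag_mx (U *m R x *m invmx U).
  have -> : U *m R x *m invmx U = U1 *m T x *m invmx U1.
    have -> : invmx U = invmx P *m invmx U1.
      apply: (can_inj (mulKmx Uu)); rewrite mulmxV // /U !mulmxA mulmxK // mulmxV //.
    by rewrite /U !mulmxA.
  apply: U1d; rewrite /T !mulmxA !mulmxKV // -[P *m R a *m R x]mulmxA Rcomm.
  by rewrite mulmxA.
clearbody U; pose q' := (linfun (mulmxr (invmx U)) \o q)%VF.
have q'E v : q' v = q v *m invmx U by rewrite comp_lfunE lfunE.
pose lam := hom_of_linear (diagl U).
have UR x : U *m R x *m invmx U = diag_mx (lam x).
  rewrite hom_of_linearE; apply/matrixP => i j; rewrite [RHS]mxE.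
  case: eqVneq => [<-|ij]; first by rewrite mulr1n [RHS]mxE.
  by have /is_diag_mxP -> := Ud x; rewrite // mulr0n.
have lamN x : (lam x == 0) = (x \in N).
  apply/eqP/idP => [lam0|xN]; last first.
    by rewrite hom_of_linearE R0 // mulmx0 mul0mx; apply/rowP => i; rewrite !mxE.
  apply: (nilR x 1%N) => r; rewrite (conjR U) //= UR lam0.
  by rewrite raddf0 mulmx0 mul0mx.
exists q', lam; split=> // [v vN|r|v x i vN|]; last exact: surj.
- rewrite q'E -qN2 //; apply/eqP/eqP => [h|->]; last exact: mul0mx.
  by rewrite -[q v](mulmxKV Uu) h mul0mx.
- exists (s (r *m U)) => //; rewrite q'E sK; exact: (mulmxK Uu).
- have -> : q' (br v x) = q' v *m diag_mx (lam x).
    by rewrite !q'E qR // -UR !mulmxA mulmxKV.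
  by rewrite mul_mx_diag mxE.
Qed.

(** The [e i] are a basis of N modulo N^2, the [x i] span an abelian complement of N and act on the
    right as the dual torus. *)
Definition diagonal_frame (e x : 'I_k -> L) :=
  [/\ forall i, e i \in N,
      forall v, v \in N -> exists a : 'I_k -> C, v - \sum_i a i *: e i \in brv br N N,
      forall a : 'I_k -> C, \sum_i a i *: e i \in brv br N N -> forall i, a i = 0,
      forall i j, br (e i) (x j) = if i == j then e i else 0 &
      [/\ forall i j, br (x i) (x j) = 0,
      forall v, exists a : 'I_k -> C, v - \sum_i a i *: x i \in N &
      forall a : 'I_k -> C, \sum_i a i *: x i \in N -> forall i, a i = 0]].

(** For z with all weights 1, right multiplication acts as m on N^m / N^(m+1). It is therefore
    injective on N, and its kernel is an abelian complement of N, in which the [x j] are the basis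
    dual to the weights. With z' the sum of the [x j], which has the same weights, the operator
    z' - 1 is injective on N^2 and maps N into it; so each class of N / N^2 has a unique
    representative fixed by z'. These representatives are the [e i]: as the [x j] commute with z',
    the error [e i, x j] - delta_ij e i is fixed by z' and lies in N^2, so it vanishes. *)
Lemma diagonal_frame_exists : exists e x, diagonal_frame e x.
Proof.
have [q [lam [qN2 qsurj qbr lsurj lN]]] := weights_on_generators.
pose LC := lower_central br N.
have LCN2 m a b : a \in LC m -> b \in brv br N N -> br a b \in LC m.+2.
  exact: lower_central_brSS.
(* The series is indexed from 0, so LC m is N^(m+1) and z acts on LC m / LC (m+1) as m + 1. *)
have grade z m v : (forall i, lam z 0 i = 1) -> v \in LC m ->
    br v z - m.+1%:R *: v \in LC m.+1.
  move=> z1; elim: m v => [|m IH] v vL.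
    rewrite /LC /= -qN2; last by rewrite rpredB ?brN // scale1r.
    by rewrite scale1r linearB subr_eq0; apply/eqP/rowP => i; rewrite qbr // z1 mulr1.
  pose f := (radm br z - m.+2%:R *: \1)%VF.
  have fE u : f u = br u z - m.+2%:R *: u.
    by rewrite /f add_lfunE opp_lfunE scale_lfunE id_lfunE radmE.
  rewrite -fE memv_preim; move: v vL; apply/subvP; apply: brv_subP => a b aL bN.
  rewrite -memv_preim fE hL.
  have -> : br (br a z) b + br a (br b z) - m.+2%:R *: br a b =
     br (br a z - m.+1%:R *: a) b + br a (br b z - b).
    rewrite brBl brZl linearB /= -[m.+2%:R]natr1 scalerDl scale1r opprD.
    by rewrite addrACA.
  apply: rpredD; first exact/lower_central_br/bN/IH.
  apply: LCN2 => //; rewrite -qN2 ?rpredB ?brN // linearB subr_eq0.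
  by apply/eqP/rowP => i; rewrite qbr // z1 mulr1.
have [_ [c hc] _] := hN.
(* Hence an eigenvalue w that is none of the integers m + 1, m + 2, ... does not occur in LC m. *)
have eig0 z m (w : C) v : (forall i, lam z 0 i = 1) -> v \in LC m ->
    (forall j, (m <= j)%N -> w != j.+1%:R) -> br v z = w *: v -> v = 0.
  move=> z1 vL wj vz; suff h j : v \in LC (m + j)%N.
    apply/eqP; rewrite -memv0 -hc.
    have := h c; rewrite addnC; elim: (m) => [|p IH]; first by rewrite addn0.
    by rewrite addnS => /(subvP (lower_centralS N2sub _)); apply: IH.
  elim: j => [|j IH]; first by rewrite addn0.
  have := grade z _ v z1 IH; rewrite vz -scalerBl addnS => h.
  rewrite -[v](scalerK (a := w - (m + j).+1%:R)); last by rewrite subr_eq0 wj // leq_addr.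
  exact: memvZ.
have sum_lam (x : 'I_k -> L) : (forall j, lam (x j) = delta_mx 0 j) ->
    forall a : 'I_k -> C, lam (\sum_j a j *: x j) = \row_j a j.
  move=> lx a; rewrite linear_sum; apply/rowP => i; rewrite summxE (bigD1 i) //= big1.
    by rewrite linearZ /= lx !mxE !eqxx mulr1 addr0.
  by move=> j ji; rewrite linearZ /= lx !mxE eq_sym (negPf ji) andbF mulr0.
have sum_q (e : 'I_k -> L) : (forall j, q (e j) = delta_mx 0 j) ->
    forall a : 'I_k -> C, q (\sum_j a j *: e j) = \row_j a j.
  move=> qe a; rewrite linear_sum; apply/rowP => i; rewrite summxE (bigD1 i) //= big1.
    by rewrite linearZ /= qe !mxE !eqxx mulr1 addr0.
  by move=> j ji; rewrite linearZ /= qe !mxE eq_sym (negPf ji) andbF mulr0.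
have [z hz] := lsurj (const_mx 1).
have z1 i : lam z 0 i = 1 by rewrite hz mxE.
have zinj v : v \in N -> br v z = 0 -> v = 0.
  move=> vN vz; apply: (eig0 z 0%N 0) => // [j _|]; last by rewrite scale0r.
  by rewrite eq_sym pnatr_eq0.
have kerz v : exists2 b, b \in N & br (v - b) z = 0.
  have [|||b bN h] := @injective_complement _ _ (radm br z) fullv N _ _ _ v (memvf v).
  - exact: subvf.
  - by move=> u _; rewrite radmE brN.
  - by move=> u uN; rewrite radmE; apply: zinj.
  by exists b; rewrite -?radmE.
have exx i : exists x, lam x = delta_mx 0 i /\ br x z = 0.
  have [y ly] := lsurj (delta_mx 0 i); have [b bN yb] := kerz y.
  exists (y - b); split=> //; rewrite linearB /= ly.
  have /eqP -> : lam b == 0 by rewrite lN.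
  exact: subr0.
have [x xP] := fin_all_exists exx.
have xx i j : br (x i) (x j) = 0.
  by apply: zinj; rewrite ?brN // hL (xP i).2 (xP j).2 br0l linear0r addr0.
pose z' := \sum_j x j.
have z'1 i : lam z' 0 i = 1.
  have -> : z' = \sum_j 1 *: x j by apply: eq_bigr => j _; rewrite scale1r.
  by rewrite sum_lam ?mxE // => j; apply: (xP j).1.
have xz' j : br (x j) z' = 0 by rewrite linear_sumr big1.
have ne1 j : (1 <= j)%N -> 1 != j.+1%:R :> C.
  by move=> j0; rewrite eq_sym (eqr_nat _ _ 1) eqSS -lt0n.
have exe i : exists e, [/\ e \in N, q e = delta_mx 0 i & br e z' = e].
  have [v vN qv] := qsurj (delta_mx 0 i).
  have [|||b bN] :=
    @injective_complement _ _ (radm br z' - \1)%VF N (brv br N N) _ _ _ v vN.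
  - exact: N2sub.
  - move=> u uN; rewrite add_lfunE opp_lfunE id_lfunE radmE.
    by have := grade z' 0%N u z'1 uN; rewrite scale1r.
  - move=> u uN2; rewrite add_lfunE opp_lfunE id_lfunE radmE => /subr0_eq uz.
    by apply: (eig0 z' 1%N 1 u z'1 uN2 ne1); rewrite scale1r.
  rewrite add_lfunE opp_lfunE id_lfunE radmE => /subr0_eq h.
  exists (v - b); split=> //; first by apply: rpredB => //; apply: (subvP N2sub).
  rewrite linearB /= qv; have /eqP -> : q b == 0 by rewrite qN2 ?(subvP N2sub).
  by rewrite subr0.
have [e eP] := fin_all_exists exe.
have eN i : e i \in N by case: (eP i).
have qe i : q (e i) = delta_mx 0 i by case: (eP i).
exists e, x; split=> // [v vN|a|i j|].
- exists (fun i => q v 0 i); rewrite -qN2; last by rewrite rpredB ?rpred_sum // => i _; rewrite memvZ.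
  by rewrite linearB /= subr_eq0 sum_q //; apply/eqP/rowP => i; rewrite mxE.
- rewrite -qN2 ?rpred_sum // => [|i _]; last by rewrite memvZ.
  by rewrite sum_q // => /eqP/rowP a0 i; have := a0 i; rewrite !mxE.
- have -> : (if i == j then e i else 0) = (i == j)%:R *: e i.
    by case: ifP; rewrite ?scale1r ?scale0r.
  apply/subr0_eq/(eig0 z' 1%N 1 _ z'1 _ ne1).
    rewrite /LC /= -qN2 ?rpredB ?memvZ // linearB linearZ /= subr_eq0.
    apply/eqP/rowP => l; rewrite qbr // qe (xP j).1 !mxE.
    by rewrite !eqxx /=; case: (eqVneq l i) => [->|_]; rewrite ?mul0r ?mulr0 // mul1r mulr1.
  have [_ _ ez] := eP i.
  by rewrite scale1r brBl brZl hL xz' linear0r addr0 ez.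
split=> // [v|a].
- exists (fun i => lam v 0 i); rewrite -lN linearB /= subr_eq0 sum_lam; last by move=> j; case: (xP j).
  by apply/eqP/rowP => i; rewrite mxE.
- rewrite -lN sum_lam; last by move=> j; case: (xP j).
  by move=> /eqP/rowP a0 i; have := a0 i; rewrite !mxE.
Qed.

(** The condition [br (x i) (e i) != 0] is decidable; in [table_exists] it turns out to single out
    the generators outside Ann_r(N). *)
Lemma ordered_frame_exists : exists (e x : 'I_k -> L) (k1 : nat),
  [/\ (k1 <= k)%N, (forall i : 'I_k, (br (x i) (e i) != 0) = (i < k1)%N) &
      diagonal_frame e x].
Proof.
have [e [x [eN emod efree ex [xx xmod xfree]]]] := diagonal_frame_exists.
have [s [k1 [sinj k1k sP]]] := sort_ord (fun i => br (x i) (e i) != 0).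
have sumE (y : 'I_k -> L) (a : 'I_k -> C) :
    \sum_i a i *: y i = \sum_i a (s i) *: y (s i) by rewrite (reindex_inj sinj).
have sumV (y : 'I_k -> L) (a : 'I_k -> C) :
    \sum_i a i *: y (s i) = \sum_i a (invF sinj i) *: y i.
  by rewrite [RHS]sumE; apply: eq_bigr => i _; rewrite invF_f.
exists (fun i => e (s i)), (fun i => x (s i)), k1; split=> //.
split=> // [v vN|a|i j|].
- by have [a] := emod v vN; rewrite sumE; exists (a \o s).
- by rewrite sumV => /efree a0 i; rewrite -(invF_f sinj i) a0.
- by rewrite ex (inj_eq sinj).
split=> // [v|a].
- by have [a] := xmod v; rewrite sumE; exists (a \o s).
- by rewrite sumV => /xfree a0 i; rewrite -(invF_f sinj i) a0.
Qed.

Lemma right_annihilated_square_sum y a b : br y (br a b + br b a) = 0.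
Proof. by rewrite linearD /= !(brNK hL) addrA subrK subrr. Qed.

Hypotheses (hns : non_split br N) (hN1 : \dim N <> 1%N).

(** A generator that brackets to zero with N spans an ideal complementary to the ideal spanned by
    the other generators and N^2. As N is non-split, N would be that line. *)
Lemma not_central_summand (e : 'I_k -> L) i :
  (forall i, e i \in N) ->
  (forall v, v \in N -> exists a : 'I_k -> C, v - \sum_i a i *: e i \in brv br N N) ->
  (forall a : 'I_k -> C, \sum_i a i *: e i \in brv br N N -> forall i, a i = 0) ->
  ~ (forall y, y \in N -> br (e i) y = 0 /\ br y (e i) = 0).
Proof.
move=> eN emod efree hc; pose e' j := if j == i then 0 else e j.
pose J := (<<[seq e' j | j : 'I_k]>> + brv br N N)%VS.
have eJ u v : u \in <[e i]>%VS -> v \in N -> br u v = 0 /\ br v u = 0.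
  by move=> /vlineP[c ->] /hc[h1 h2]; rewrite brZl linearZ /= h1 h2 scaler0.
have e0 : e i != 0.
  apply/eqP => ei0; suff /efree/(_ i)/eqP : \sum_j (j == i)%:R *: e j \in brv br N N.
    by rewrite eqxx oner_eq0.
  by rewrite (bigD1 i) //= ei0 scaler0 add0r big1 ?mem0v // => j /negPf ->; rewrite scale0r.
have Iid : ideal br N <[e i]>%VS.
  split; first by rewrite -memvE.
  - by apply: brv_subP => u v uI vN; rewrite (eJ u v uI vN).1 mem0v.
  - by apply: brv_subP => v u vN uI; rewrite (eJ u v uI vN).2 mem0v.
have JN : (J <= N)%VS.
  rewrite subv_add N2sub andbT; apply/span_subvP => _ /mapP[j _ ->].
  by rewrite /e'; case: eqP; rewrite ?mem0v.
have Jid : ideal br N J.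
  split=> //; apply: subv_trans (addvSr _ _); apply: brvS => //; exact: subvv.
have IJ : (<[e i]> + J)%VS = N.
  apply/eqP; rewrite eqEsubv subv_add JN andbT -memvE eN /=.
  apply/subvP => v /emod[a h].
  have -> : v = a i *: e i + (\sum_j a j *: e' j + (v - \sum_j a j *: e j)).
    rewrite (bigD1 i) //= [\sum_j a j *: e j](bigD1 i) //= {1}/e' eqxx scaler0 add0r.
    rewrite [\sum_(j | _) a j *: e' j](eq_bigr (fun j => a j *: e j)); last first.
      by move=> j /negPf ji; rewrite /e' ji.
    by rewrite [RHS]addrA [RHS]addrC subrK.
  apply: memv_add; first by rewrite memvZ ?memv_line.
  by apply: memv_add => //; apply/span_ordP; exists a.
have IJ0 : (<[e i]> :&: J)%VS = 0%VS.
  apply/eqP; rewrite -subv0; apply/subvP => v; rewrite memv_cap memv0.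
  move=> /andP[/vlineP[c ->] /memv_addP[_ /span_ordP[a ->] [n nN2 E]]].
  pose b j := if j == i then c else - a j.
  have /(_ i) : forall j, b j = 0.
    apply: efree; suff -> : \sum_j b j *: e j = n by [].
    rewrite (bigD1 i) //= {1}/b eqxx E (bigD1 i) //= {1}/e' eqxx scaler0 add0r.
    rewrite addrAC -big_split big1 /= ?add0r // => j /negPf ji.
    by rewrite /b /e' ji scaleNr subrr.
  by rewrite /b eqxx => ->; rewrite scale0r eqxx.
case: (hns Iid Jid IJ IJ0) => h.
  by have := memv_line (e i); rewrite h memv0 (negPf e0).
by apply: hN1; rewrite -IJ h addv0 dim_vline e0.
Qed.

(** The basis consists of the one-letter words followed by longer words. Products of
    the [x j] with words, on either side, are eigenvectors for all right multiplications by the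
    [x l], and the weights of a word are the numbers of its letters; comparing weights leaves the
    coefficients that the table allows. *)
Lemma table_exists : has_table br k N.
Proof.
have [e [x [k1 [k1k hk1 [eN emod efree ex [xx xmod xfree]]]]]] :=
  ordered_frame_exists.
have [_ Nnil _] := hN.
have gen := generates_mod_square hL N2sub Nnil eN emod.
pose W0 := [seq [:: i] | i : 'I_k].
have sW0 : size W0 = k by rewrite size_image card_ord.
have W0e : [seq iter_bracket br e p | p <- W0] = [seq e i | i : 'I_k].
  by rewrite -map_comp; apply: eq_map.
have W0n : [::] \notin W0 by apply/mapP => -[].
have efree0 : free [seq e i | i : 'I_k].
  by apply/free_ordP => a a0; apply: efree; rewrite a0 mem0v.
have [|W1 [W1n Wb]] := word_basis_extend N2sub gen W0n; first by rewrite W0e.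
have W1s p : p \in W1 -> (1 < size p)%N.
  move=> pW; have := free_uniq (basis_free Wb) => /map_uniq.
  rewrite cat_uniq => /and3P[_ /hasPn/(_ p pW) pW0 _].
  case: p pW pW0 => [|i [|//]] pW; first by rewrite pW in W1n.
  by rewrite /= image_f.
pose m := size W1; pose W := W0 ++ W1.
have sW : size W = (k + m)%N by rewrite size_cat sW0.
pose w (i : 'I_m) := nth [::] W1 i.
pose E (t : 'I_(k + m)) := iter_bracket br e (nth [::] W t).
have EW : [seq E t | t : 'I_(k + m)] = [seq iter_bracket br e p | p <- W].
  rewrite -[W in RHS](mkseq_nth [::]) sW /mkseq -map_comp -val_enum_ord -map_comp.
  by [].
have El i : E (lshift m i) = e i.
  rewrite /E nth_cat sW0 /= ltn_ord (nth_map i) ?size_enum_ord //.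
  by rewrite nth_ord_enum.
have Er i : E (rshift k i) = iter_bracket br e (w i).
  by rewrite /E nth_cat sW0 /= ltnNge leq_addr addKn.
have wW i : w i \in W1 by rewrite mem_nth.
have w0 i : w i != [::] by apply: contra W1n => /eqP <-.
have Eb : basis_of N (mktuple E) by move: Wb; rewrite -EW.
have xE l i : br (E (rshift k i)) (x l) = (alpha w i l)%:R *: E (rshift k i).
  rewrite Er -radmE (@weight_word _ _ br N _ e N2sub _ (fun j => (j == l)%:R)) //.
  - congr (_ *: _); rewrite /alpha -sum1_count natr_sum [RHS]big_mkcond.
    by apply: eq_bigr => j _ /=; case: eqP.
  - by move=> u v _ _; rewrite !radmE.
  - by move=> i'; rewrite radmE ex; case: eqP; rewrite ?scale1r ?scale0r.
pose Y := mktuple (fun t => E (rshift k t)).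
have YW : val Y = [seq iter_bracket br e p | p <- W1].
  rewrite -[W1 in RHS](mkseq_nth [::]) /mkseq -map_comp -val_enum_ord -map_comp.
  by apply: eq_map => i /=; rewrite Er.
have dimm : \dim (brv br N N) = m.
  have := dimN; rewrite (size_basis Eb) addnC => /addIn ->.
  by [].
have EN2 i : E (rshift k i) \in brv br N N by rewrite Er word_mem_brv // W1s.
have Yb : basis_of (brv br N N) Y.
  rewrite basisEfree; apply/and3P; split.
  - by have := basis_free Wb; rewrite map_cat => /catr_free; rewrite -YW.
  - by apply/span_subvP => _ /mapP[i _ ->].
  - by rewrite dimm size_tuple.
have Ycoord v : v \in brv br N N -> v = \sum_t coord Y t v *: E (rshift k t).
  move=> vN; rewrite {1}(coord_basis Yb vN); apply: eq_bigr => t _.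
  by rewrite -tnth_nth tnth_mktuple.
have leftN2 y v : v \in brv br N N -> br y v \in brv br N N.
  have /subvP h : (brv br N N <= ladm br y @^-1: brv br N N)%VS.
    by apply: brv_subP => a b aN bN; rewrite -memv_preim ladmE (brNK hL) memvB // mem_brv.
  by move=> /h; rewrite -memv_preim ladmE.
have leftx y l v (c : C) : br y (x l) = 0 -> br v (x l) = c *: v ->
    br (br y v) (x l) = c *: br y v.
  by move=> yl vl; rewrite hL yl br0l add0r vl linearZ.
have alphaE i t : (forall l, (alpha w t l)%:R = (alpha w i l)%:R :> C) -> same_structure w i t.
  by move=> h; apply/forallP => l; have /eqP := h l; rewrite eqr_nat eq_sym.
have xnong j i : br (x j) (E (rshift k i)) =
    \sum_(t | same_structure w i t) coord Y t (br (x j) (E (rshift k i))) *: E (rshift k t).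
  rewrite {1}(Ycoord (br (x j) (E (rshift k i)))); last exact: leftN2.
  rewrite [RHS]big_mkcond; apply: eq_bigr => t _; case: ifPn => // nst.
  case: (eqVneq (coord Y t (br (x j) (E (rshift k i)))) 0) => [->|c0]; first by rewrite scale0r.
  case/negP: nst; apply: alphaE => l.
  apply: (@eigen_coord _ _ _ Y (radm br (x l)) (fun t => (alpha w t l)%:R) _ _
            (basis_free Yb) _ _ _ t c0).
  - by move=> t'; rewrite -tnth_nth tnth_mktuple radmE xE.
  - by rewrite (span_basis Yb) leftN2.
  - by rewrite radmE; apply: leftx.
(* [x_j, e_i] has the weights of e_i, and no other basis word does: longer words weigh more. *)
have xgen0 j i : exists c, br (x j) (e i) = c *: e i.
  set v := br (x j) (e i).
  pose wt l (t : 'I_(k + m)) : C :=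
    match split t with inl t' => (t' == l)%:R | inr t' => (alpha w t' l)%:R end.
  have Ewt l t : br (E t) (x l) = wt l t *: E t.
    rewrite /wt; case: split_ordP => t' ->; last exact: xE.
    by rewrite El ex; case: eqP; rewrite ?scale1r ?scale0r.
  have cw t : coord (mktuple E) t v != 0 -> forall l, wt l t = (i == l)%:R.
    move=> c0 l.
    apply: (@eigen_coord _ _ _ (mktuple E) (radm br (x l)) (wt l) _ v (basis_free Eb) _ _ _ t c0).
    - by move=> t'; rewrite -tnth_nth tnth_mktuple radmE Ewt.
    - by rewrite (span_basis Eb) brN.
    - by rewrite radmE; apply: leftx => //; rewrite ex; case: eqP; rewrite ?scale1r ?scale0r.
  exists (coord (mktuple E) (lshift m i) v).
  have vN : v \in N by apply: brN.
  have vE : v = \sum_t coord (mktuple E) t v *: E t.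
    rewrite {1}(coord_basis Eb vN); apply: eq_bigr => t _.
    by rewrite -tnth_nth tnth_mktuple.
  rewrite {1}vE big_split_ord /= [X in _ + X]big1 ?addr0; last first.
    move=> t _; case: (eqVneq (coord (mktuple E) (rshift k t) v) 0) => [->|c0].
      by rewrite scale0r.
    have := W1s _ (wW t); rewrite -sum_count_size.
    rewrite (eq_bigr (fun l => (i == l) : nat)); last first.
      move=> l _; have := cw _ c0 l; rewrite /wt; case: split_ordP => [? /eqP|t' /rshift_inj <-].
        by rewrite eq_rlshift.
      by move=> /eqP; rewrite eqr_nat => /eqP.
    rewrite (bigD1 i) //= eqxx big1 // => l; rewrite eq_sym => /negPf -> //.
  rewrite (bigD1 i) //= El big1 ?addr0 // => t ti.
  case: (eqVneq (coord (mktuple E) (lshift m t) v) 0) => [->|c0]; first by rewrite scale0r.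
  have := cw _ c0 i; rewrite /wt eqxx; case: split_ordP => [t' /lshift_inj <-|? /eqP].
    by rewrite (negPf ti) => /eqP; rewrite eq_sym oner_eq0.
  by rewrite eq_lrshift.
have e0 i : e i != 0 by apply: (free_not0 efree0); apply: image_f.
(* e_i is a multiple of the left-annihilated sum of [e_i, x_j] and [x_j, e_i], unless that is 0. *)
have cancels j i c : br (x j) (e i) = c *: e i -> (if i == j then 1 else 0) + c != 0 ->
    forall y, br y (e i) = 0.
  move=> hc nz y; apply: (scalerI nz); rewrite scaler0 -linearZ scalerDl -hc.
  have -> : (if i == j then 1 else 0) *: e i = br (e i) (x j).
    by rewrite ex; case: ifP; rewrite ?scale1r ?scale0r.
  exact: right_annihilated_square_sum.
have xgen j i : br (x j) (e i) = 0 \/ (i = j /\ br (x j) (e i) = - e i).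
  have [c hc] := xgen0 j i; have := cancels j i c hc.
  case: (eqVneq (_ + c) 0) => [c0 _|nz /(_ isT)]; last by left.
  move: c0; case: eqVneq => [ij|_]; last by rewrite add0r => c0; left; rewrite hc c0 scale0r.
  by move=> /eqP; rewrite addrC addr_eq0 => /eqP c1; right; rewrite hc c1 scaleN1r.
(* If [x_i, e_i] = - e_i although e_i is in Ann_r(N), then for y in N left multiplication by x_i
   maps [e_i, y] both to - [e_i, y] and to 0, so e_i brackets to zero with N. *)
have annr (i : 'I_k) : (i < k1)%N <-> ~ right_annihilator br N (e i).
  rewrite -hk1; split=> [nz [_ ann]|nann].
    case: (xgen i i) => [h|[_ xi]]; first by rewrite h eqxx in nz.
    apply: (@not_central_summand e i eN emod efree) => y yN.
    split; last exact: ann.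
    have := right_annihilated_square_sum (x i) (e i) y.
    rewrite (ann y yN) addr0 (brNK hL) xi ann ?brN // subr0 linearNl => /eqP.
    by rewrite oppr_eq0 => /eqP.
  apply/negP => /eqP xi; apply: nann; split=> // y _; apply: (cancels i i 0).
    by rewrite xi scale0r.
  by rewrite eqxx addr0 oner_neq0.
exists m, E, x, k1, w, (fun i j t => coord Y t (br (E i) (E j))),
  (fun j i t => coord Y t (br (x j) (E (rshift k i)))).
have gE : generators E = <<[seq e i | i : 'I_k]>>%VS.
  by rewrite /generators; congr span; apply: eq_map => i; apply: El.
split; split=> //.
- rewrite gE; apply/eqP; rewrite eqEsubv subv_add N2sub andbT; apply/andP; split.
    by apply/span_subvP => _ /mapP[i _ ->].
  apply/subvP => v /emod[a h]; rewrite -(subrK (\sum_i a i *: e i) v) addrC.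
  by apply: memv_add => //; apply/span_ordP; exists a.
- rewrite gE; apply/eqP; rewrite -subv0; apply/subvP => v; rewrite memv_cap memv0.
  move=> /andP[/span_ordP[a ->] /efree a0]; rewrite big1 // => i _.
  by rewrite a0 scale0r.
- by move=> i; rewrite El; apply: annr.
- by move=> i; apply: W1s.
- by move=> i; rewrite Er; apply: eq_iter_bracket => j; rewrite El.
- by apply/free_ordP => a a0; apply: xfree; rewrite a0 mem0v.
- apply/eqP; rewrite eqEsubv subvf /=; apply/subvP => v _.
  have [a h] := xmod v; rewrite -(subrK (\sum_i a i *: x i) v).
  by apply: memv_add => //; apply/span_ordP; exists a.
- apply/eqP; rewrite -subv0; apply/subvP => v; rewrite memv_cap memv0.
  move=> /andP[vN /span_ordP[a E']]; rewrite E'; rewrite E' in vN.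
  by rewrite big1 // => i _; rewrite (xfree _ vN) scale0r.
- move=> i j; apply: Ycoord; apply: mem_brv.
    by rewrite -(tnth_mktuple E) (basis_mem Eb) // mem_tnth.
  by rewrite -(tnth_mktuple E) (basis_mem Eb) // mem_tnth.
- by move=> i j; rewrite El.
- move=> j i; rewrite El; case: eqVneq => [->|ij] /=; last first.
    by case: (xgen j i) => // -[h]; rewrite h eqxx in ij.
  rewrite -hk1; case: eqVneq => //= nz; case: (xgen j j) => [h|[_ ->//]].
  by rewrite h eqxx in nz.
Qed.

End Existence.

(** * Comparing two gradings of a nilpotent algebra *)

Section Homs.
Variables (F : fieldType) (L A : vectType F).
Variables (br : {bilinear L -> L -> L}) (brA : {bilinear A -> A -> A}).

Lemma lfun_inverse_on (f : 'Hom(L, A)) (U : {vspace L}) (V : {vspace A}) :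
  (f @: U)%VS = V -> {in U &, injective f} ->
  exists g : 'Hom(A, L), [/\ forall u, u \in U -> g (f u) = u,
    forall v, v \in V -> f (g v) = v & forall v, g v \in U].
Proof.
move=> fU finj; pose h := (f \o projv U)%VF; pose g := (projv U \o h^-1)%VF.
have gU v : g v \in U by rewrite comp_lfunE memv_proj.
have fg v : v \in V -> f (g v) = v.
  rewrite -fU => /memv_imgP[u uU ->].
  have fh : f u \in limg h.
    by apply/memv_imgP; exists u; rewrite ?memvf // comp_lfunE projv_id.
  by rewrite /g comp_lfunE -[RHS](limg_lfunVK fh) [h _]comp_lfunE.
exists g; split=> // u uU; apply: finj => //; rewrite fg // -fU; exact: memv_img.
Qed.

Lemma hom_of_basis (U : {vspace L}) (f : 'Hom(L, A)) (n : nat) (X : n.-tuple L) :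
  basis_of U X ->
  (forall i j : 'I_n, f (br X`_i X`_j) = brA (f X`_i) (f X`_j)) ->
  {in U &, forall u v, f (br u v) = brA (f u) (f v)}.
Proof.
move=> Xb h u v uU vU.
have hi (i : 'I_n) : f (br X`_i v) = brA (f X`_i) (f v).
  rewrite (coord_basis Xb vU) linear_sumr !(linear_sum f) linear_sumr.
  by apply: eq_bigr => j _; rewrite !linearZ /= h.
rewrite (coord_basis Xb uU) br_suml !(linear_sum f) br_suml.
by apply: eq_bigr => i _; rewrite brZl !linearZ /= hi brZl.
Qed.

End Homs.

Section Derivations.
Variables (F : numFieldType) (L : vectType F) (br : {bilinear L -> L -> L}).
Variable N : {vspace L}.
Hypothesis Nsub : (brv br N N <= N)%VS.

Definition derivation (D : 'End(L)) :=
  (forall v, v \in N -> D v \in N) /\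
  {in N &, forall u v, D (br u v) = br (D u) v + br u (D v)}.

Definition automorphism (f : 'End(L)) :=
  (f @: N)%VS = N /\ {in N &, forall u v, f (br u v) = br (f u) (f v)}.

Inductive eigensum (D : 'End(L)) (P : F -> Prop) : L -> Prop :=
| Eigensum0 : eigensum D P 0
| EigensumD b v u of P b & v \in N & D v = b *: v & eigensum D P u :
    eigensum D P (v + u).

Lemma eigensum1 (D : 'End(L)) (P : F -> Prop) b v :
  P b -> v \in N -> D v = b *: v -> eigensum D P v.
Proof. by move=> Pb vN Dv; rewrite -[v]addr0; apply: (EigensumD Pb) => //; apply: Eigensum0. Qed.

Lemma eigensum_add D P u v : eigensum D P u -> eigensum D P v -> eigensum D P (u + v).
Proof.
by elim=> [|b w z Pb wN Dw _ IH] hv; rewrite ?add0r // -addrA; apply: (EigensumD Pb); auto.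
Qed.

Lemma eigensum_scale D P c v : eigensum D P v -> eigensum D P (c *: v).
Proof.
elim=> [|b w z Pb wN Dw _ IH]; first by rewrite scaler0; apply: Eigensum0.
rewrite scalerDr; apply: (EigensumD Pb) => //; first exact: memvZ.
by rewrite linearZ /= Dw !scalerA mulrC.
Qed.

Lemma eigensum_sum D P (I : finType) (f : I -> L) :
  (forall i, eigensum D P (f i)) -> eigensum D P (\sum_i f i).
Proof. by move=> h; elim/big_ind: _ => [|u v|//]; [exact: Eigensum0 | exact: eigensum_add]. Qed.

Lemma eigensum_br (D : 'End(L)) (P Q T : F -> Prop) u v : derivation D ->
  (forall a b, P a -> Q b -> T (a + b)) ->
  eigensum D P u -> eigensum D Q v -> eigensum D T (br u v).
Proof.
move=> [_ DM] PQT; elim=> [|a w z Pa wN Dw _ IH] hv.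
  by rewrite br0l; apply: Eigensum0.
rewrite brDl; apply: eigensum_add; last exact: IH.
elim: hv => [|b w' z' Qb wN' Dw' _ IH']; first by rewrite linear0; apply: Eigensum0.
rewrite linearD; apply: (EigensumD (PQT _ _ Pa Qb)) => //; first exact: brvN.
by rewrite DM // Dw Dw' brZl linearZ scalerDl.
Qed.

(** Eigenvectors for different eigenvalues are independent: the product of the [D - b] over the
    eigenvalues b that occur kills [v], but multiplies it by the nonzero product of the [a - b]. *)
Lemma eigensum_eigenvector (D : 'End(L)) (P : F -> Prop) a v :
  eigensum D P v -> D v = a *: v -> (forall b, P b -> b != a) -> v = 0.
Proof.
move=> Pv Dv Pa; pose ev s u := foldr (fun b u => D u - b *: u) u s.
have evD s u z : ev s (u + z) = ev s u + ev s z.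
  by elim: s => //= b s ->; rewrite linearD scalerDr opprD addrACA.
have evC s b u : ev s (D u - b *: u) = D (ev s u) - b *: ev s u.
  elim: s => //= c s ->; move: (ev s u) => z.
  rewrite !raddfB /= ![D (_ *: z)]linearZ /= !scalerA [c * b]mulrC.
  by rewrite addrACA.
have ev0 s : ev s 0 = 0 by elim: s => //= b s ->; rewrite linear0 scaler0 subrr.
have [s sP s0] : exists2 s, forall c, c \in s -> P c & ev s v = 0.
  elim: Pv => [|b w z Pb wN Dw _ [s sP s0]]; first by exists [::].
  exists (b :: s) => [c|]; first by rewrite inE => /orP[/eqP ->|/sP].
  by rewrite /= -evC linearD /= scalerDr opprD addrACA Dw subrr add0r evC s0 linear0 scaler0 subrr.
have evE : ev s v = (\prod_(c <- s) (a - c)) *: v.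
  elim: (s) => [|c s' /= ->]; first by rewrite big_nil scale1r.
  by rewrite linearZ /= Dv big_cons !scalerA -scalerBl mulrBl [_ * a]mulrC.
move/eqP: s0; rewrite evE scaler_eq0 => /orP[|/eqP //].
rewrite prodf_seq_eq0 => /hasP[c cs]; rewrite /= subr_eq0 eq_sym.
by rewrite (negPf (Pa c (sP c cs))).
Qed.

Lemma aut_inj f : automorphism f -> {in N &, injective f}.
Proof.
move=> [fN _] u v uN vN fuv; apply/eqP; rewrite -subr_eq0 -memv0.
have <- : (N :&: lker f)%VS = 0%VS.
  apply/eqP; rewrite -dimv_eq0; have := limg_ker_dim f N.
  by rewrite fN => /eqP; rewrite -[X in _ == X]add0n eqn_add2r.
by rewrite memv_cap memvB //= memv_ker linearB /= fuv subrr.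
Qed.

Lemma aut_mem f v : automorphism f -> v \in N -> f v \in N.
Proof. by move=> [fN _] vN; rewrite -fN memv_img. Qed.

Lemma aut_comp f g : automorphism f -> automorphism g -> automorphism (f \o g)%VF.
Proof.
move=> af ag; have [fN fM] := af; have [gN gM] := ag; split; first by rewrite limg_comp gN.
by move=> u v uN vN; rewrite !comp_lfunE gM // fM // aut_mem.
Qed.

Section LeadingPart.
Variables (k : nat) (e f : 'I_k -> L) (w : 'I_k -> F) (D D' : 'End(L)).
Hypotheses (ge : generates br N e) (gf : generates br N f).
Hypotheses (hD : derivation D) (hD' : derivation D').
Hypotheses (De : forall i, D (e i) = w i *: e i) (Df : forall i, D' (f i) = w i *: f i).
Hypothesis ef : forall i, eigensum D' (fun b => b < w i) (e i - f i).

(** [u'] is the component of [u] of the largest D'-weight [a]. The relation is functional and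
    multiplicative, and words in the [e i] are related to the same words in the [f i]. *)
Let leading a u u' :=
  [/\ u \in N, u' \in N, D' u' = a *: u' & eigensum D' (fun b => b < a) (u - u')].

Let leading0 a : leading a 0 0.
Proof.
split; rewrite ?mem0v //; first by rewrite linear0 scaler0.
by rewrite subrr; apply: Eigensum0.
Qed.

Let leading_uniq a u u1 u2 : leading a u u1 -> leading a u u2 -> u1 = u2.
Proof.
move=> [_ _ D1 l1] [_ _ D2 l2]; apply/subr0_eq.
have l : eigensum D' (fun b => b < a) (u1 - u2).
  have -> : u1 - u2 = (u - u2) + (-1) *: (u - u1).
    by rewrite scaleN1r opprB [RHS]addrC addrA subrK.
  by apply: eigensum_add => //; apply: eigensum_scale.
apply: (eigensum_eigenvector (a := a) l) => [|b]; last by move=> /lt_eqF ->.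
by rewrite linearB /= D1 D2 scalerBr.
Qed.

Let leading_br a b u u' v v' :
  leading a u u' -> leading b v v' -> leading (a + b) (br u v) (br u' v').
Proof.
move=> [uN uN' Du lu] [vN vN' Dv lv].
have Du1 : eigensum D' (fun c => c = a) u' by apply: (eigensum1 (erefl a)).
have Dv1 : eigensum D' (fun c => c = b) v' by apply: (eigensum1 (erefl b)).
split; [exact: brvN | exact: brvN | by rewrite hD'.2 // Du Dv brZl linearZ scalerDl |].
have -> : br u v - br u' v' = br (u - u') (v - v') + (br (u - u') v' + br u' (v - v')).
  by rewrite addrA -linearD /= subrK brBl linearB /= addrA subrK.
apply: eigensum_add; first by apply: (eigensum_br hD' _ lu lv) => c d; apply: ltrD.
apply: eigensum_add.
  by apply: (eigensum_br hD' _ lu Dv1) => c d ca ->; rewrite ltrD2r.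
by apply: (eigensum_br hD' _ Du1 lv) => c d -> db; rewrite ltrD2l.
Qed.

Let leading_word p : p != [::] ->
  leading (\sum_(j <- p) w j) (iter_bracket br e p) (iter_bracket br f p).
Proof.
have lg i : leading (w i) (e i) (f i) by split=> //; [exact: ge.1 | exact: gf.1].
elim/word_ind: p / => [i|p i p0 IH]; first by rewrite big_seq1.
by rewrite -cats1 big_cat big_seq1 cats1 !iter_bracket_rcons //; apply: leading_br.
Qed.

(** Taking the leading part of each D-eigenvector is linear on D-eigenspaces and multiplicative, so
    it is an endomorphism of N. It is defined on a basis of words; it is onto as the [f i]
    generate. *)
Lemma leading_part_automorphism :
  exists2 phi, automorphism phi & forall i, phi (e i) = f i.
Proof.
have eN := ge.1; have fN := gf.1.
have [|W [Wn Wb]] := word_basis_extend Nsub ge (W0 := [::]) isT; first exact: nil_free.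
rewrite /= in Wb; pose X := map_tuple (iter_bracket br e) (in_tuple W).
pose Y := map_tuple (iter_bracket br f) (in_tuple W).
have Xb : basis_of N X by [].
have [phi0 phiX] := linear_of_free X Y; pose phi := linfun phi0.
have phiE i : phi X`_i = Y`_i.
  have [il|il] := ltnP i (size X); last first.
    by rewrite !nth_default ?linear0 // ?size_tuple // -(size_tuple X).
  by rewrite lfunE -(nth_map 0 0 phi0 il) phiX ?(basis_free Xb) ?size_tuple.
pose wt (i : 'I_(size W)) := \sum_(j <- nth [::] W i) w j.
have lX (i : 'I_(size W)) : leading (wt i) X`_i Y`_i.
  rewrite !(nth_map [::]) //; apply: leading_word.
  by apply: contra Wn => /eqP <-; rewrite mem_nth.
have DX (i : 'I_(size W)) : D X`_i = wt i *: X`_i.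
  rewrite !(nth_map [::]) //; apply: (weight_word Nsub hD.2 eN De).
  by apply: contra Wn => /eqP <-; rewrite mem_nth.
(* All basis words in the expansion of a D-eigenvector have its weight. *)
have lphi a u : u \in N -> D u = a *: u -> leading a u (phi u).
  move=> uN Du; rewrite [u in phi u](coord_basis Xb uN) [u in leading a u](coord_basis Xb uN).
  rewrite linear_sum; elim/big_ind2: _ => [|u1 v1 u2 v2 [a1 a2 a3 a4] [b1 b2 b3 b4]|i _].
  - exact: leading0.
  - split; [exact: memvD | exact: memvD | by rewrite linearD /= a3 b3 scalerDr |].
    by rewrite opprD addrACA; apply: eigensum_add.
  have [->|ci] := eqVneq (coord X i u) 0.
    by rewrite !scale0r linear0; apply: leading0.
  rewrite linearZ /= phiE; have [c1 c2 c3 c4] := lX i.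
  have <- : wt i = a.
    by apply: (eigen_coord (basis_free Xb) DX _ Du ci); rewrite (span_basis Xb).
  split; [exact: memvZ | exact: memvZ | by rewrite linearZ /= c3 !scalerA mulrC |].
  by rewrite -scalerBr; apply: eigensum_scale.
have phiM : {in N &, forall u v, phi (br u v) = br (phi u) (phi v)}.
  apply: (hom_of_basis Xb) => i j.
  have XN (l : 'I_(size W)) : X`_l \in N by case: (lX l).
  apply: (@leading_uniq (wt i + wt j) (br X`_i X`_j)).
    by apply: lphi; rewrite ?brvN // hD.2 // !DX brZl linearZ scalerDl.
  by rewrite !phiE; apply: leading_br.
have phie i : phi (e i) = f i.
  by apply: (@leading_uniq (w i) (e i)); [exact: lphi | split].
have phiN : (phi @: N <= N)%VS.
  apply/subvP => _ /memv_imgP[u uN ->]; rewrite (coord_basis Xb uN) linear_sum.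
  by apply: memv_suml => i _; rewrite linearZ memvZ //= phiE; case: (lX i).
exists phi => //; split=> //; apply/eqP; rewrite eqEsubv phiN /=.
apply: gf.2 => [i|u i _ /memv_imgP[v vN ->]]; first by rewrite -phie memv_img.
by rewrite -phie -phiM // memv_img // brvN.
Qed.

End LeadingPart.
End Derivations.

(** * Conjugacy of the diagonal tori *)

Section TorusSystem.
Variables (F : numFieldType) (L : vectType F) (br : {bilinear L -> L -> L}).
Variable N : {vspace L}.

(** A torus of rank k in Der(N), given by generators [e i] of N and the derivations dual to them. *)
Record torus_system k (e : 'I_k -> L) (D : 'I_k -> 'End(L)) : Prop := TorusSystem {
  torus_gen : generates br N e;
  torus_der : forall j, derivation br N (D j);
  torus_eig : forall i j, D j (e i) = (i == j)%:R *: e i;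
  torus_neq0 : forall i, e i != 0
}.

End TorusSystem.

Definition isomorphism (F : fieldType) (L A : vectType F)
    (br : {bilinear L -> L -> L}) (U : {vspace L})
    (brA : {bilinear A -> A -> A}) (V : {vspace A}) (f : 'Hom(L, A)) :=
  [/\ (f @: U)%VS = V, {in U &, injective f} &
      {in U &, forall x y, f (br x y) = brA (f x) (f y)}].

Section Isomorphism.
Variables (F : numFieldType) (L A : vectType F).
Variables (br : {bilinear L -> L -> L}) (brA : {bilinear A -> A -> A}).
Variables (N : {vspace L}) (M : {vspace A}) (f : 'Hom(L, A)).
Hypothesis Nsub : (brv br N N <= N)%VS.
Hypothesis fiso : isomorphism br N brA M f.

Lemma iso_mem v : v \in N -> f v \in M.
Proof. by case: fiso => <- _ _; apply: memv_img. Qed.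

Lemma iso_inverse : exists2 g : 'Hom(A, L), isomorphism brA M br N g &
  (forall u, u \in N -> g (f u) = u) /\ (forall v, v \in M -> f (g v) = v).
Proof.
have [fN finj fM] := fiso; have [g [gf fg gN]] := lfun_inverse_on fN finj.
exists g => //; split=> [|u v uM vM E|u v uM vM].
- apply/eqP; rewrite eqEsubv; apply/andP; split; apply/subvP => u.
    by move=> /memv_imgP[v _ ->].
  by move=> uN; rewrite -(gf u uN) memv_img // iso_mem.
- by rewrite -(fg u uM) E fg.
- have uv : brA u v \in M.
    by rewrite -(fg u uM) -(fg v vM) -fM // iso_mem // brvN.
  by apply: finj; rewrite ?brvN // fM // !fg.
Qed.

Lemma torus_system_iso k (e : 'I_k -> L) D :
  torus_system br N e D -> exists D', torus_system brA M (fun i => f (e i)) D'.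
Proof.
move=> [ge dD De e0]; have [g giso [gf fg]] := iso_inverse.
have [fN finj fM] := fiso; have [gN _ gM] := giso.
have eN := ge.1; have gmem v : v \in M -> g v \in N by move=> vM; rewrite -gN memv_img.
exists (fun j => f \o (D j \o g))%VF; split=> [|j|i j|i].
- split=> [i|S Se Sbr]; first exact: iso_mem.
  rewrite -fN; apply/subvP => _ /memv_imgP[u uN ->].
  suff /subvP/(_ _ uN) : (N <= f @^-1: S)%VS by rewrite -memv_preim.
  apply: ge.2 => [i|u' i u'N]; rewrite -!memv_preim // => h.
  by rewrite fM // Sbr // iso_mem.
- split=> [v vN|u v uN vN]; rewrite !comp_lfunE.
    by apply/iso_mem/(dD j).1/gmem.
  by rewrite gM // (dD j).2 ?gmem // linearD /= !fM ?(dD j).1 ?gmem // !fg.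
- by rewrite !comp_lfunE gf // De linearZ.
- apply: contra (e0 i) => /eqP pe; apply/eqP/finj; [exact: eN | exact: mem0v |].
  by rewrite pe linear0.
Qed.

End Isomorphism.

Lemma iso_comp (F : fieldType) (L A B : vectType F) (br : {bilinear L -> L -> L})
    (brA : {bilinear A -> A -> A}) (brB : {bilinear B -> B -> B}) U V W
    (f : 'Hom(L, A)) (g : 'Hom(A, B)) :
  isomorphism br U brA V f -> isomorphism brA V brB W g ->
  isomorphism br U brB W (g \o f).
Proof.
move=> [fU finj fM] [gV ginj gM].
have fmem u : u \in U -> f u \in V by move=> uU; rewrite -fU memv_img.
split=> [|u v uU vU|u v uU vU]; first by rewrite limg_comp fU.
  by rewrite !comp_lfunE => /ginj/finj; apply; rewrite ?fmem.
by rewrite !comp_lfunE fM // gM // fmem.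
Qed.

Section Conjugacy.
Variables (F : numFieldType) (L : vectType F) (br : {bilinear L -> L -> L}).
Variable N : {vspace L}.
Hypothesis Nsub : (brv br N N <= N)%VS.

Local Notation derivation := (derivation br N).
Local Notation automorphism := (automorphism br N).
Local Notation generates := (generates br N).
Local Notation "'span' e" := <<[seq e i | i : 'I__]>>%VS (at level 10, e at level 8).

Lemma derivation_comb a D E : derivation D -> derivation E -> derivation (a *: D + E).
Proof.
move=> [DN DM] [EN EM]; split=> [v vN|u v uN vN].
  by rewrite add_lfunE scale_lfunE memvD ?memvZ ?DN ?EN.
rewrite !add_lfunE !scale_lfunE DM // EM // brDl brZl brDr brZr scalerDr.
by rewrite addrACA.
Qed.

Lemma derivation0 : derivation 0.
Proof.
split=> [v|u v _ _]; first by rewrite zero_lfunE mem0v.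
by rewrite !zero_lfunE br0l br0r addr0.
Qed.

Lemma derivation_opp D : derivation D -> derivation (- D).
Proof.
move=> hD; rewrite -scaleN1r -[X in derivation X]addr0.
exact/derivation_comb/derivation0.
Qed.

Lemma derivation_sum (I : finType) (D : I -> 'End(L)) :
  (forall i, derivation (D i)) -> derivation (\sum_i D i).
Proof.
move=> h; elim/big_ind: _ => [|D1 D2 h1 h2|//]; first exact: derivation0.
by rewrite -[D1]scale1r; apply: derivation_comb.
Qed.

Definition commutator (D E : 'End(L)) : 'End(L) := (D \o E)%VF - (E \o D)%VF.

Lemma commutatorE D E v : commutator D E v = D (E v) - E (D v).
Proof. by rewrite add_lfunE opp_lfunE !comp_lfunE. Qed.

Lemma derivation_commutator D E : derivation D -> derivation E -> derivation (commutator D E).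
Proof.
move=> [DN DM] [EN EM]; split=> [v vN|u v uN vN].
  by rewrite commutatorE; apply: memvB; auto.
rewrite !commutatorE EM // DM // [D (_ + _)]linearD [E (_ + _)]linearD /=.
rewrite !DM ?EN ?DN // !EM ?DN ?EN // brBl brBr.
rewrite [br (E (D u)) v + _ + _]addrACA opprD addrACA [br (E (D u)) v + _]addrC addrKA.
by rewrite [br (D u) (E v) + br u (D (E v))]addrC addrKA.
Qed.

Lemma generates_span k (e f : 'I_k -> L) :
  generates e -> (forall i, f i \in N) -> (forall i, e i \in span f) -> generates f.
Proof.
move=> [eN gen] fN ef; split=> // S fS Sbr.
have eP i : exists a, e i = \sum_j a j *: f j by apply/span_ordP.
apply: gen => [i|u i uN uS]; have [a ->] := eP i.
  by apply: memv_suml => j _; rewrite memvZ.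
by rewrite linear_sumr; apply: memv_suml => j _; rewrite linearZ memvZ //= Sbr.
Qed.

(** A surjective endomorphism of a finite-dimensional space is injective. *)
Lemma automorphism_iso phi : automorphism phi -> isomorphism br N br N phi.
Proof. by move=> ap; split; [exact: ap.1 | exact: aut_inj ap | exact: ap.2]. Qed.

(** One Steinitz step. On the span of the generators, [X = Df s] is the projection to the line of
    [f s], and [X (h j) = b j *: f s]. As [X (f s) = f s], some coordinate [a o] of [f s] has
    [a o * b o != 0]. The part of X of weight -1 for the commutator action of [D o] is again a
    derivation: it maps [h o] to a multiple of [f s - a o *: h o] and the other generators to 0.
    Added to [D o] with the right factor, it gives a derivation D2 that is diagonal for the system
    in which [f s / a o] replaces [h o], and the leading part lemma turns this replacement into an
    automorphism. *)
Lemma torus_exchange k (h f : 'I_k -> L) D Df (s : 'I_k) :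
  torus_system br N h D -> torus_system br N f Df ->
  (forall i, f i \in span h) -> (forall i, h i \in span f) ->
  exists phi (o : 'I_k) (a : F),
    [/\ automorphism phi, a != 0, f s = a *: phi (h o), forall i, i != o -> phi (h i) = h i &
     [/\ Df s (h o) != 0, forall i, f i \in span (fun i => phi (h i)) &
      forall i, phi (h i) \in span f]].
Proof.
move=> [gh dD Dh h0] [gf dDf Dff f0] fh hf.
have [a fs] : exists a, f s = \sum_j a j *: h j by apply/span_ordP.
have Xspan i : exists b, Df s (h i) = b *: f s.
  have [b ->] : exists b, h i = \sum_j b j *: f j by apply/span_ordP.
  exists (b s); rewrite linear_sum (bigD1 s) //= linearZ /= Dff eqxx scale1r.
  by rewrite big1 ?addr0 // => j /negPf js; rewrite linearZ /= Dff js scale0r scaler0.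
have [b Xh] := fin_all_exists Xspan.
pose X := Df s; have Xfs : X (f s) = f s by rewrite /X Dff eqxx scale1r.
have [o abo] : exists o, a o * b o != 0.
  apply/existsP; apply: contraT; rewrite negb_exists => /forallP ab0.
  case/eqP: (f0 s); rewrite -Xfs {1}fs linear_sum big1 // => j _.
  have /negPn/eqP := ab0 j; rewrite linearZ /= /X Xh scalerA => ->.
  by rewrite scale0r.
have [ao bo] : a o != 0 /\ b o != 0 by apply/andP; rewrite -negb_or -mulf_eq0.
pose Do := D o; have Doh i : Do (h i) = (i == o)%:R *: h i by apply: Dh.
have Dofs : Do (f s) = a o *: h o.
  rewrite fs linear_sum (bigD1 o) //= linearZ /= Doh eqxx scale1r big1 ?addr0 //.
  by move=> j /negPf jo; rewrite linearZ /= Doh jo scale0r scaler0.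
(* On the generators ad (D o) has eigenvalues -1, 0 and 1 on the components of X, so
   (ad ^ 2 - ad) / 2 is the projection to the component of weight -1. *)
pose Z := commutator Do X; pose Z2 := commutator Do Z.
have Zh i : Z (h i) = (b i * a o) *: h o - ((i == o)%:R * b i) *: f s.
  rewrite commutatorE /X Xh Doh linearZ [Df s _]linearZ /= Dofs Xh !scalerA. by [].
pose D2 := (2%:R * b o * a o)^-1 *: (Z2 - Z) + Do.
pose G := (a o)^-1 *: f s; pose h' i := if i == o then G else h i.
have two : 2%:R != 0 :> F by rewrite pnatr_eq0.
have D2h i : D2 (h i) = if i == o then G else 0.
  have Z2h : Z2 (h i) = Do (Z (h i)) - (i == o)%:R *: Z (h i).
    by rewrite commutatorE Doh linearZ.
  have DoZ : Do (Z (h i)) = (b i * a o) *: h o - ((i == o)%:R * b i * a o) *: h o.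
    rewrite Zh linearB /= linearZ [Do (_ *: f s)]linearZ /= Doh Dofs eqxx scale1r.
    by rewrite scalerA.
  rewrite add_lfunE scale_lfunE add_lfunE opp_lfunE Z2h DoZ Zh Doh.
  case: eqVneq => [->|_]; last by rewrite !mul0r !scale0r !subr0 subrr scaler0 addr0.
  rewrite !mul1r !scale1r.
  rewrite subrr sub0r !opprB -mulr2n -scaler_nat scalerA.
  have -> : (2%:R * b o * a o)^-1 * 2%:R = (b o * a o)^-1.
    by rewrite -mulrA invfM mulrAC mulVf // mul1r.
  rewrite scalerBr !scalerA mulVf ?mulf_neq0 // scale1r subrK.
  by rewrite invfM mulrAC mulVf // mul1r.
have dDf' := dDf s; have dDo := dD o.
have dZ : derivation Z by apply: derivation_commutator.
have dZ2 : derivation Z2 by apply: derivation_commutator.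
have dD2 : derivation D2.
  apply: derivation_comb => //.
  by rewrite addrC -[- Z]scaleN1r; apply: derivation_comb.
have fsG : f s = a o *: G by rewrite scalerA divff // scale1r.
have D2G : D2 G = G.
  rewrite [in LHS]/G linearZ /= fs linear_sum (bigD1 o) //= linearZ /= D2h eqxx big1 ?addr0.
    by rewrite scalerA mulVf // scale1r.
  by move=> j /negPf jo; rewrite linearZ /= D2h jo scaler0.
have h'o : h' o = G by rewrite /h' eqxx.
have h'i i : i != o -> h' i = h i by rewrite /h' => /negPf ->.
have hN := gh.1; have fN := gf.1.
have h'N i : h' i \in N by rewrite /h'; case: ifP => _; rewrite ?memvZ.
have h'f i : h' i \in span f.
  rewrite /h'; case: ifP => _ //; apply/memvZ/memv_span; exact: image_f.
have h'mem i : h' i \in span h' by apply/memv_span/image_f.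
have hh' i : h i \in span h'.
  have [->|io] := eqVneq i o; last by rewrite -h'i.
  have -> : h o = (a o)^-1 *: (a o *: h' o - \sum_(j | j != o) a j *: h' j).
    rewrite h'o -fsG fs (bigD1 o) //= (eq_bigr (fun j => a j *: h' j)).
      by rewrite addrK scalerA mulVf // scale1r.
    by move=> j jo; rewrite h'i.
  by rewrite memvZ // memvB ?memvZ // memv_suml // => j _; rewrite memvZ.
have fh' i : f i \in span h'.
  have /span_ordP[c ->] := fh i.
  by apply: memv_suml => j _; apply: memvZ.
have gh' : generates h' by apply: (generates_span gh).
have [phi ap phih] : exists2 phi, automorphism phi & forall i, phi (h i) = h' i.
  apply: (@leading_part_automorphism _ _ br N Nsub k h h' (fun i => (i == o)%:R) Do D2) => // i.
    rewrite /h'; case: ifP => [_|/negbT io]; first by rewrite scale1r.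
    by rewrite D2h (negPf io) scale0r.
  have [->|io] := eqVneq i o; last by rewrite h'i // subrr; apply: Eigensum0.
  apply: (@eigensum1 _ _ N D2 _ 0); rewrite ?memvB ?ltr01 //.
  by rewrite linearB /= D2h h'o D2G eqxx subrr scale0r.
exists phi, o, (a o); split=> //; first by rewrite phih h'o.
  by move=> i io; rewrite phih h'i.
have Espan : span (fun i => phi (h i)) = span h'.
  by congr (<<_>>)%VS; apply: eq_map.
split=> [|i|i]; rewrite ?Espan ?phih //.
by rewrite Xh scaler_eq0 negb_or bo f0.
Qed.

End Conjugacy.

Section Conjugacy.
Variables (F : numFieldType) (L : vectType F) (br : {bilinear L -> L -> L}).
Variable N : {vspace L}.
Hypothesis Nsub : (brv br N N <= N)%VS.

Local Notation derivation := (derivation br N).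
Local Notation automorphism := (automorphism br N).
Local Notation generates := (generates br N).
Local Notation "'span' e" := <<[seq e i | i : 'I__]>>%VS (at level 10, e at level 8).

(** Modulo N^2 the generators [e' i] are combinations [f i] of the [e j], and N^2 is a sum of weight
    spaces of degree at least 2 for the grading given by [e]. With the opposites of the total
    degrees in the roles of D and D', the [f i] are the leading parts of the [e' i]. *)
Lemma torus_linear_part k (e e' : 'I_k -> L) D D' :
  torus_system br N e D -> torus_system br N e' D' ->
  (forall v, v \in N -> exists a : 'I_k -> F, v - \sum_i a i *: e i \in brv br N N) ->
  (forall a : 'I_k -> F, \sum_i a i *: e i \in brv br N N -> forall i, a i = 0) ->
  (forall v, v \in N -> exists a : 'I_k -> F, v - \sum_i a i *: e' i \in brv br N N) ->
  exists phi, [/\ automorphism phi, forall i, phi (e' i) \in span e &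
    forall i, e i \in span (fun i => phi (e' i))].
Proof.
move=> [ge dD De e0] [ge' dD' De' e'0] emod efree e'mod.
have eN := ge.1; have e'N := ge'.1.
have [a aP] := fin_all_exists (fun i => emod _ (e'N i)).
pose f i := \sum_j a i j *: e j.
have fN i : f i \in N by apply: memv_suml => j _; apply: memvZ.
have fe i : f i \in span e by apply/span_ordP; exists (a i).
have ef i : e i \in span f.
  have [b hb] := e'mod _ (eN i); apply/span_ordP; exists b; apply/subr0_eq.
  have [c hc] : exists c, e i - \sum_j b j *: f j = \sum_j c j *: e j.
    apply/span_ordP; rewrite memvB ?memv_suml // => [|j _]; last exact: memvZ.
    by apply/memv_span/image_f.
  have : e i - \sum_j b j *: f j \in brv br N N.
    rewrite -(subrK (\sum_j b j *: e' j) (e i)) -addrA memvD // -sumrB memv_suml // => j _.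
    by rewrite -scalerBr memvZ.
  by rewrite hc => /efree c0; rewrite big1 // => j _; rewrite c0 scale0r.
have gf : generates f by apply: generates_span ge fN ef.
pose E := - \sum_j D j; pose E' := - \sum_j D' j.
have dE : derivation E by apply/derivation_opp/derivation_sum.
have dE' : derivation E' by apply/derivation_opp/derivation_sum.
have sumE (g : 'I_k -> L) (G : 'I_k -> 'End(L)) i :
    (forall i j, G j (g i) = (i == j)%:R *: g i) ->
    (- \sum_j G j) (g i) = (-1) *: g i.
  move=> Gg; rewrite scaleN1r opp_lfunE sum_lfunE (bigD1 i) //= Gg eqxx scale1r big1 ?addr0 //.
  by move=> j ji; rewrite Gg eq_sym (negPf ji) scale0r.
(* N carries E-weights at most -1, hence N^2 at most -2. *)
have NE v : v \in N -> eigensum N E (fun b => b <= -1) v.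
  move=> vN; have [|W [Wn Wb]] := word_basis_extend Nsub ge (W0 := [::]) isT; first exact: nil_free.
  rewrite /= in Wb; have Xb : basis_of N (map_tuple (iter_bracket br e) (in_tuple W)) by [].
  rewrite (coord_basis Xb vN); apply: eigensum_sum => i; apply: eigensum_scale.
  rewrite (nth_map [::]) //; set p := nth _ _ _.
  have p0 : p != [::] by apply: contra Wn => /eqP <-; rewrite mem_nth.
  apply: (@eigensum1 _ _ N E _ (\sum_(j <- p) (-1))).
  - case: (p) p0 => // j p' _; rewrite big_cons gerDl.
    by apply: sumr_le0 => _ _; rewrite lerN10.
  - exact: word_mem.
  - by apply: (weight_word Nsub dE.2 eN _ p0) => j; apply: sumE.
have N2E v : v \in brv br N N -> eigensum N E (fun b => b < -1) v.
  move=> vN; rewrite (coord_span (X := in_tuple _) vN); apply: eigensum_sum => i.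
  apply: eigensum_scale; set s := [seq br u v | u <- vbasis N, v <- vbasis N] in i *.
  have /allpairsP[[x y] [/= xN yN ->]] : (in_tuple s)`_i \in s.
    by apply: mem_nth; apply: ltn_ord.
  apply: (eigensum_br Nsub dE _ (NE _ (vbasis_mem xN)) (NE _ (vbasis_mem yN))) => b c b1 c1.
  apply: le_lt_trans (lerD b1 c1) _.
  by rewrite gtrDl ltrN10.
have [phi ap phie] : exists2 phi, automorphism phi & forall i, phi (e' i) = f i.
  apply: (@leading_part_automorphism _ _ br N Nsub k e' f (fun=> -1) E' E) => // i.
  - exact: sumE.
  - rewrite /f linear_sum scaler_sumr; apply: eq_bigr => j _.
    by rewrite linearZ /= sumE // !scalerA mulrC.
  - exact/N2E/aP.
exists phi; split=> // i; first by rewrite phie.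
by have -> : span (fun i => phi (e' i)) = span f by congr (<<_>>)%VS; apply: eq_map.
Qed.

(** After r exchanges the lines of [f 0], ..., [f (r - 1)] are lines of the moved system. A later
    exchange does not disturb them: the generator that it replaces is not killed by [Df r], whereas
    [f t] with [t < r] is. *)
Lemma torus_conjugate k (e f : 'I_k -> L) D Df :
  torus_system br N e D -> torus_system br N f Df ->
  (forall i, f i \in span e) -> (forall i, e i \in span f) ->
  exists phi (tau : 'I_k -> 'I_k) (c : 'I_k -> F),
    [/\ automorphism phi, injective tau, forall s, c s != 0 &
        forall s, f s = c s *: phi (e (tau s))].
Proof.
move=> se sf fe ef.
have stage r : (r <= k)%N -> exists phi, [/\ automorphism phi,
    forall i, f i \in span (fun i => phi (e i)), forall i, phi (e i) \in span f &
    forall s : 'I_k, (s < r)%N -> exists j c, c != 0 /\ f s = c *: phi (e j)].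
  elim: r => [_|r IH rk].
    exists \1%VF; have idE : span (fun i => \1%VF (e i)) = span e.
      by congr (<<_>>)%VS; apply: eq_map => i; rewrite id_lfunE.
    split=> //; first split; first by rewrite lim1g.
    + by move=> u v _ _; rewrite !id_lfunE.
    + by rewrite idE.
    + by move=> i; rewrite id_lfunE.
  have [phi [ap fphi phif ms]] := IH (ltnW rk).
  have [Dh sh] := torus_system_iso Nsub (automorphism_iso ap) se.
  pose s := Ordinal rk.
  have [psi [o [a [apsi a0 fs psih [Xo fpsi psif]]]]] := torus_exchange Nsub s sh sf fphi phif.
  exists (psi \o phi)%VF.
  have E : span (fun i => (psi \o phi)%VF (e i)) = span (fun i => psi (phi (e i))).
    by congr (<<_>>)%VS; apply: eq_map => i; rewrite comp_lfunE.
  split; [exact: aut_comp | by rewrite E | by move=> i; rewrite comp_lfunE |].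
  move=> t; rewrite ltnS leq_eqVlt => /orP[/eqP tr|tr].
    exists o, a; split=> //; rewrite comp_lfunE -fs; congr f; exact/val_inj.
  have [j [c [c0 ft]]] := ms t tr; exists j, c; split=> //.
  rewrite comp_lfunE psih //; apply: contra Xo => /eqP <-.
  have -> : phi (e j) = c^-1 *: f t by rewrite ft scalerA mulVf // scale1r.
  rewrite linearZ /= (torus_eig sf); have -> : (t == s) = false by rewrite -val_eqE /= ltn_eqF.
  by rewrite scale0r scaler0.
have [phi [ap _ _ m]] := stage k (leqnn k).
have [tau taup] := fin_all_exists (fun s : 'I_k => m s (ltn_ord s)).
have [c cP] := fin_all_exists taup.
exists phi, tau, c; split=> // [s t st|s|s]; [|by case: (cP s)|by case: (cP s)].
have [[cs0 fs] [ct0 ft]] := (cP s, cP t).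
have fst : f s = (c s / c t) *: f t by rewrite fs st ft scalerA mulfVK.
apply/eqP; apply: contraT => nst; case/eqP: (torus_neq0 sf s).
have := torus_eig sf s s; rewrite eqxx scale1r => <-.
by rewrite fst linearZ /= (torus_eig sf) eq_sym (negPf nst) scale0r scaler0.
Qed.

End Conjugacy.

(** * Extending isomorphisms of the nilradicals *)

Section TorusExtension.
Variables (F : numFieldType) (L : vectType F) (br : {bilinear L -> L -> L}).
Variable N : {vspace L}.

(** The part of a table that already determines the algebra up to isomorphism. *)
Record torus_extension k (e x : 'I_k -> L) (k1 : nat) : Prop := TorusExtension {
  ext_sub : (brv br N N <= N)%VS;
  ext_sys : torus_system br N e (fun j => radm br (x j));
  ext_mod : forall v, v \in N ->
    exists a : 'I_k -> F, v - \sum_i a i *: e i \in brv br N N;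
  ext_free : forall a : 'I_k -> F, \sum_i a i *: e i \in brv br N N -> forall i, a i = 0;
  ext_left : forall j i : 'I_k,
    br (x j) (e i) = if (i == j) && (i < k1)%N then - e i else 0;
  ext_leftN : forall j u, u \in N -> br (x j) u \in N;
  ext_annr : forall i : 'I_k, (i < k1)%N <-> ~ right_annihilator br N (e i);
  ext_xx : forall i j, br (x i) (x j) = 0;
  ext_xfree : free [seq x j | j : 'I_k];
  ext_xsum : (N + <<[seq x j | j : 'I_k]>>)%VS = fullv;
  ext_xcap : (N :&: <<[seq x j | j : 'I_k]>>)%VS = 0%VS
}.

Hypothesis hL : leibniz_identity br.

Lemma table_torus_extension k : has_table br k N ->
  exists (e x : 'I_k -> L) k1, torus_extension e x k1.
Proof.
move=> [m [E [x [k1 [w [gam [beta]]]]]]].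
move=> [[EN gsum gcap _ annr nong sw ww xf xs xc] [ee ex xe nx xn xx]].
pose e i := E (lshift m i).
have Eb : basis_of N (mktuple E) by [].
have EinN t : E t \in N by rewrite (basis_mem EN) // image_f.
have Nind (S : {vspace L}) : (forall t, E t \in S) -> (N <= S)%VS.
  by move=> ES; rewrite -(span_basis EN); apply/span_subvP => _ /mapP[t _ ->].
have EE i j : br (E i) (E j) \in N.
  by rewrite ee memv_suml // => t _; rewrite memvZ.
have Nsub : (brv br N N <= N)%VS.
  apply: brv_subP => u v uN vN.
  suff /subvP/(_ u uN) : (N <= radm br v @^-1: N)%VS by rewrite -memv_preim radmE.
  apply: (Nind) => t; rewrite -memv_preim radmE -ladmE memv_preim; move: v vN.
  apply/subvP; apply: (Nind (ladm br (E t) @^-1: N)%VS) => t'; by rewrite -memv_preim ladmE.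
have eN i : e i \in N by apply: EinN.
have ge : generates br N e.
  split=> // S eS Sbr; apply: Nind => t; case: (split_ordP t) => i ->; first exact: eS.
  rewrite ww; have : w i != [::] by case: (w i) (sw i).
  suff h p : p != [::] -> iter_bracket br e p \in S by apply: h.
  elim/word_ind: p / => [j|p j p0 IH]; first exact: eS.
  by rewrite iter_bracket_rcons // Sbr // (word_mem Nsub).
have gE : generators E = <<[seq e i | i : 'I_k]>>%VS by [].
have efree0 : free [seq e i | i : 'I_k].
  apply/free_ordP => a a0 i; have /free_ordP h := basis_free EN.
  have := h (fun t => match split t with inl i => a i | inr _ => 0 end) _ (lshift m i).
  case: split_ordP => [i' /lshift_inj <-|? /eqP]; last by rewrite eq_lrshift.
  apply; rewrite big_split_ord /= [X in _ + X]big1 ?addr0 => [|j _].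
    rewrite -[RHS]a0; apply: eq_bigr => j _.
    by case: split_ordP => [? /lshift_inj <-|? /eqP] //; rewrite eq_lrshift.
  by case: split_ordP => [? /eqP|? _]; rewrite ?eq_rlshift ?scale0r.
have gsub j i : br (e i) (x j) = (i == j)%:R *: e i.
  by rewrite ex; case: eqP; rewrite ?scale1r ?scale0r.
exists e, x, k1; split=> //.
- split=> // [j|i j|i].
  + split=> [v vN|u v _ _]; last by rewrite !radmE hL.
    suff /subvP/(_ v vN) : (N <= radm br (x j) @^-1: N)%VS by rewrite -memv_preim.
    apply: Nind => t; rewrite -memv_preim radmE; case: (split_ordP t) => i ->.
      by rewrite -/(e i) gsub memvZ.
    by rewrite nx memvZ.
  + by rewrite radmE gsub.
  + by apply: (free_not0 efree0); apply: image_f.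
- move=> v; rewrite -{1}gsum gE => /memv_addP[_ /span_ordP[a ->] [n nN ->]].
  by exists a; rewrite addrC addKr.
- move=> a aN2; have /free_ordP h := efree0; apply: h; apply/eqP; rewrite -memv0 -gcap memv_cap aN2 andbT.
  by rewrite gE; apply/span_ordP; exists a.
- move=> j u uN; suff /subvP/(_ u uN) : (N <= ladm br (x j) @^-1: N)%VS by rewrite -memv_preim ladmE.
  apply: Nind => t; rewrite -memv_preim ladmE; case: (split_ordP t) => i ->.
    by rewrite xe; case: ifP => _; rewrite ?memvN ?mem0v.
  by rewrite xn memv_suml // => t' _; rewrite memvZ.
Qed.

End TorusExtension.

Section Extend.
Variables (F : numFieldType) (L A : vectType F).
Variables (br : {bilinear L -> L -> L}) (brA : {bilinear A -> A -> A}).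
Hypotheses (hL : leibniz_identity br) (hA : leibniz_identity brA).
Variables (N : {vspace L}) (M : {vspace A}) (k : nat).
Variables (e x : 'I_k -> L) (k1 : nat) (e' x' : 'I_k -> A) (k1' : nat).
Hypotheses (he : torus_extension br N e x k1) (he' : torus_extension brA M e' x' k1').

(** The images of the [x i] are forced by the permutation [s]. Compatibility with the right and left
    multiplications by [x j] spreads from the generators to N by the Leibniz identity. On a
    generator, the left multiplication depends only on whether the generator is in Ann_r(N), which
    [th] respects. *)
Lemma torus_extension_isomorphic (th : 'Hom(L, A)) (s : 'I_k -> 'I_k) (d : 'I_k -> F) :
  isomorphism br N brA M th -> injective s -> (forall i, d i != 0) ->
  (forall i, th (e i) = d i *: e' (s i)) -> isomorphic br fullv brA fullv.
Proof.
move=> thiso sinj d0 the; have [thN thinj thM] := thiso.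
have thmem v : v \in N -> th v \in M by apply: iso_mem thiso _.
case: he => Nsub [ge dD De e0] _ _ xe leftN annr xx xfree xsum xcap.
case: he' => Msub [ge' dD' De' e'0] _ _ xe' leftM annr' xx' xfree' xsum' xcap'.
have eN := ge.1; have e'N := ge'.1.
have thx u j : u \in N -> th (br u (x j)) = brA (th u) (x' (s j)).
  move=> uN; pose f := (th \o radm br (x j))%VF; pose g := (radm brA (x' (s j)) \o th)%VF.
  suff /eqlfun_inP/(_ u uN) : (N <= lker (f - g))%VS by rewrite !comp_lfunE !radmE.
  apply: ge.2 => [i|v i vN /eqlfunP]; first apply/eqlfunP.
    rewrite !comp_lfunE De linearZ /= the radmE brZl -[brA (e' _) _]radmE De'.
    by rewrite !scalerA mulrC (inj_eq sinj).
  rewrite !comp_lfunE !radmE => h; apply/eqlfunP; rewrite !comp_lfunE !radmE.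
  have xN w : w \in N -> br w (x j) \in N by move=> wN; rewrite -radmE; apply: (dD j).1.
  rewrite hL linearD /= [th (br (br v _) _)]thM ?xN ?eN // h.
  rewrite [th (br v (br _ _))]thM ?xN ?eN // [th (br v (e i))]thM ?eN // [RHS]hA.
  congr (_ + brA _ _).
  rewrite -[br (e i) _]radmE De linearZ /= the brZl -[brA (e' _) _]radmE De'.
  by rewrite !scalerA mulrC (inj_eq sinj).
have kk (i : 'I_k) : (i < k1)%N = (s i < k1')%N.
  suff h : right_annihilator br N (e i) <-> right_annihilator brA M (e' (s i)).
    by apply/idP/idP => [/annr|/annr'] ni; [apply/annr' => /h|apply/annr => /h].
  split=> [[_ h]|[_ h]]; split=> // y.
    rewrite -thN => /memv_imgP[u uN ->]; apply: (scalerI (d0 i)).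
    by rewrite scaler0 -brZr -the -thM ?eN // h // linear0.
  move=> yN; apply: thinj; rewrite ?mem0v ?brvN ?eN // thM ?eN // the brZr.
  by rewrite h ?thmem // scaler0 linear0.
have xth u j : u \in N -> th (br (x j) u) = brA (x' (s j)) (th u).
  move=> uN; pose f := (th \o ladm br (x j))%VF; pose g := (ladm brA (x' (s j)) \o th)%VF.
  have base i : th (br (x j) (e i)) = brA (x' (s j)) (th (e i)).
    rewrite xe the brZr xe' (inj_eq sinj) kk; case: ifP => _; last by rewrite linear0 scaler0.
    by rewrite linearN /= the scalerN.
  suff /eqlfun_inP/(_ u uN) : (N <= lker (f - g))%VS by rewrite !comp_lfunE !ladmE.
  apply: ge.2 => [i|v i vN /eqlfunP]; first by apply/eqlfunP; rewrite !comp_lfunE !ladmE.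
  rewrite !comp_lfunE !ladmE => h; apply/eqlfunP; rewrite !comp_lfunE !ladmE.
  rewrite (brNK hL) linearB /= [th (br (br _ v) _)]thM ?leftN ?eN // h.
  rewrite [th (br (br _ (e i)) _)]thM ?leftN ?eN // base [th (br v _)]thM ?eN //.
  by rewrite (brNK hA).
pose X := <<[seq x j | j : 'I_k]>>%VS; pose xt := mktuple x.
pose G v := th (daddv_pi N X v) + \sum_i coord xt i (daddv_pi X N v) *: x' (s i).
have Glin : linear G.
  move=> a u v; rewrite /G !linearP scalerDr addrACA; congr (_ + _).
  rewrite scaler_sumr -big_split; apply: eq_bigr => i _ /=.
  by rewrite !linearP scalerDl scalerA.
pose g := hom_of_linear Glin.
have xcap2 : (X :&: N)%VS = 0%VS by rewrite capvC.
have gN u : u \in N -> g u = th u.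
  move=> uN; rewrite hom_of_linearE /G daddv_pi_id //.
  have := daddv_pi_add xcap2 (w := u); rewrite addvC xsum memvf => /(_ isT).
  rewrite [X in _ + X = _]daddv_pi_id // => /(canRL (addrK _)); rewrite subrr => ->.
  by rewrite big1 ?addr0 // => i _; rewrite linear0 scale0r.
have gx i : g (x i) = x' (s i).
  have xX : x i \in X by apply/memv_span/image_f.
  rewrite hom_of_linearE /G [daddv_pi X N _]daddv_pi_id //.
  have := daddv_pi_add xcap (w := x i); rewrite xsum memvf => /(_ isT).
  rewrite [X in _ + X = _]daddv_pi_id // => /(canRL (addrK _)); rewrite subrr => ->.
  rewrite linear0 add0r (bigD1 i) //= -{1}(tnth_mktuple x i) (tnth_nth 0) coord_free // eqxx.
  rewrite scale1r big1 ?addr0 // => j ji.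
  by rewrite -{1}(tnth_mktuple x i) (tnth_nth 0) coord_free // eq_sym (negPf ji) scale0r.
have full (S : {vspace L}) : (N <= S)%VS -> (forall i, x i \in S) -> forall v, v \in S.
  move=> NS xS v; suff /subvP : (fullv <= S)%VS by apply; apply: memvf.
  by rewrite -xsum subv_add NS; apply/span_subvP => _ /mapP[i _ ->].
exists g; split.
- apply/eqP; rewrite eqEsubv subvf /= -xsum' subv_add; apply/andP; split.
    by rewrite -thN; apply/subvP => _ /memv_imgP[u uN ->]; rewrite -gN // memv_img ?memvf.
  apply/span_subvP => _ /mapP[i _ ->].
  by rewrite -(f_invF sinj i) -gx memv_img ?memvf.
- suff /lker0P ginj : lker g == 0%VS by move=> u v _ _; apply: ginj.
  rewrite -subv0; apply/subvP => v; rewrite memv_ker memv0 => /eqP gv.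
  have := memvf v; rewrite -xsum => /memv_addP[n nN [y /span_ordP[a ->] E]].
  have gE : g v = th n + \sum_i a (invF sinj i) *: x' i.
    rewrite E linearD /= gN // linear_sum [X in _ = _ + X](reindex_inj sinj) /=.
    by congr (_ + _); apply: eq_bigr => i _; rewrite linearZ /= gx invF_f.
  have S0 : \sum_i a (invF sinj i) *: x' i = 0.
    apply/eqP; rewrite -memv0 -xcap' memv_cap; apply/andP; split; last by apply/span_ordP; eexists.
    have -> : \sum_i a (invF sinj i) *: x' i = - th n.
      by apply/eqP; rewrite -addr_eq0 addrC -gE gv.
    by rewrite memvN thmem.
  have a0 i : a i = 0.
    by have /free_ordP/(_ _ S0 (s i)) := xfree'; rewrite invF_f.
  move: gE; rewrite gv S0 addr0 => /esym th0.
  have n0 : n = 0 by apply: thinj; rewrite ?mem0v ?linear0.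
  by rewrite E n0 add0r big1 // => i _; rewrite a0 scale0r.
move=> u v _ _.
have key u' v' : (u' \in N \/ exists i, u' = x i) -> (v' \in N \/ exists i, v' = x i) ->
    g (br u' v') = brA (g u') (g v').
  move=> [u'N|[i ->]] [v'N|[j ->]].
  - by rewrite !gN ?brvN // thM.
  - by rewrite gx !gN ?thx // -radmE (dD j).1.
  - by rewrite gx !gN ?xth // leftN.
  - by rewrite !gx xx xx' linear0.
have key2 u' : (u' \in N \/ exists i, u' = x i) -> g (br u' v) = brA (g u') (g v).
  move=> hu; have := full (lker ((g \o ladm br u') - (ladm brA (g u') \o g))%VF) _ _ v.
  have kp v' : (v' \in N \/ exists i, v' = x i) ->
      v' \in lker ((g \o ladm br u') - (ladm brA (g u') \o g))%VF.
    by move=> hv; apply/eqlfunP; rewrite !comp_lfunE !ladmE key.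
  move=> /(_ _ _)/eqlfunP; rewrite !comp_lfunE !ladmE; apply.
    by apply/subvP => v' v'N; apply: kp; left.
  by move=> i; apply: kp; right; exists i.
have kp u' : (u' \in N \/ exists i, u' = x i) ->
    u' \in lker ((g \o radm br v) - (radm brA (g v) \o g))%VF.
  by move=> hu; apply/eqlfunP; rewrite !comp_lfunE !radmE key2.
have := full (lker ((g \o radm br v) - (radm brA (g v) \o g))%VF) _ _ u.
move=> /(_ _ _)/eqlfunP; rewrite !comp_lfunE !radmE; apply.
  by apply/subvP => v' v'N; apply: kp; left.
by move=> i; apply: kp; right; exists i.
Qed.

End Extend.

(** The second torus is carried to N by the given isomorphism of nilradicals and conjugated there
    into the first one. *)
Lemma torus_extension_unique (F : numFieldType) (L A : vectType F)
    (br : {bilinear L -> L -> L}) (brA : {bilinear A -> A -> A})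
    (N : {vspace L}) (M : {vspace A}) k (e x : 'I_k -> L) k1 (e' x' : 'I_k -> A) k1' :
  leibniz_identity br -> leibniz_identity brA ->
  torus_extension br N e x k1 -> torus_extension brA M e' x' k1' ->
  isomorphic br N brA M -> isomorphic br fullv brA fullv.
Proof.
move=> hL hA he he' [f fiso].
have Nsub := ext_sub he; have Msub := ext_sub he'.
have [g giso [gf fg]] := iso_inverse Nsub fiso.
have [D' sys'] := torus_system_iso Msub giso (ext_sys he').
have [gM _ gbr] := giso; have [fN _ fbr] := fiso.
have emod' v : v \in N -> exists a : 'I_k -> F, v - \sum_i a i *: g (e' i) \in brv br N N.
  move=> vN; have [a h] := ext_mod he' (iso_mem fiso vN); exists a.
  have -> : v - \sum_i a i *: g (e' i) = g (f v - \sum_i a i *: e' i).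
    rewrite linearB /= gf // (linear_sum g); congr (_ - _); apply: eq_bigr => i _.
    by rewrite linearZ.
  rewrite memv_preim; move: h; apply/subvP; apply: brv_subP => u w uM wM.
  by rewrite -memv_preim gbr // mem_brv // -gM memv_img.
have [phi0 [ap0 phi0e ephi0]] :=
  torus_linear_part Nsub (ext_sys he) sys' (ext_mod he) (ext_free he) emod'.
have [D'' sys''] := torus_system_iso Nsub (automorphism_iso ap0) sys'.
have [phi [tau [c [ap tauinj c0 phiE]]]] := torus_conjugate Nsub (ext_sys he) sys'' phi0e ephi0.
have [h hiso [hphi0 phi0h]] := iso_inverse Nsub (automorphism_iso ap0).
have thiso := iso_comp (automorphism_iso ap) (iso_comp hiso fiso).
pose s := invF tauinj.
have sinj : injective s by apply: (can_inj (f_invF tauinj)).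
apply: (torus_extension_isomorphic hL hA he he' (s := s) (d := fun i => (c (s i))^-1) thiso sinj).
  by move=> i; rewrite invr_eq0.
have e'M i : e' i \in M by apply: (torus_gen (ext_sys he')).1.
move=> i; have phie : phi (e i) = (c (s i))^-1 *: phi0 (g (e' (s i))).
  by rewrite phiE scalerA mulVf // scale1r f_invF.
by rewrite !comp_lfunE phie !linearZ /= hphi0 ?fg // -gM memv_img.
Qed.

(* The algebra R of the mathematics is (L, br), over the complex numbers RT[i].

   hN1 cannot be dropped: the Lie algebra with basis (e, x) and brackets
   [e, x] = e = - [x, e] has nilradical N = <e> = Ann_r(N), so k = 1 and
   k_1 = 0, and the table would require [x, e] = 0. *)
Theorem proposition4p1 (RT : realType) (L : vectType RT[i])
    (br : {bilinear L -> L -> L}) (N Q : {vspace L}) (k : nat)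
    (hL : leibniz_identity br) (hsolv : solvable br fullv)
    (hN : nilradical br N)
    (hsum : (N + Q)%VS = fullv) (hcap : (N :&: Q)%VS = 0%VS)
    (hQ : \dim Q = k) (hk : \dim N = (\dim (brv br N N) + k)%N)
    (hns : non_split br N) (hN1 : \dim N <> 1%N) :
  has_table br k N /\
  (forall (A : vectType RT[i]) (brA : {bilinear A -> A -> A})
          (NA : {vspace A}),
     leibniz_identity brA -> isomorphic br N brA NA -> has_table brA k NA ->
     isomorphic br fullv brA fullv).
Proof.
have dimL : \dim (fullv : {vspace L}) = (\dim N + k)%N.
  by rewrite -hsum dimv_disjoint_sum // hQ.
have tab := table_exists hL hsolv hN dimL hk hns hN1.
split=> // A brA NA hA iso tabA.
have [e [x [k1 he]]] := table_torus_extension hL tab.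
have [e' [x' [k1' he']]] := table_torus_extension hA tabA.
exact: (torus_extension_unique hL hA he he' iso).
Qed.
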